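(* Let $m\ge 1$ and $n\ge 1$ be integers, and let $Q_m$ be a set of $m$ distinct points in the sphere $S^2$. The topological complexity of the configuration space of $n$ distinct ordered points on $S^2\smallsetminus Q_m$ is \[ \mathsf{TC}(F(S^2\smallsetminus Q_m,n))=\begin{cases} 1&\text{if } m=1 \text{ and } n=1,\\ 2n-2&\text{if } m=1 \text{ and } n\ge 2,\\ 2n&\text{if } m=2 \text{ and } n\ge 1,\\ 2n+1&\text{if } m\ge 3 \text{ and } n\ge 1. \end{cases} \]
   Context: For a topological space $X$ and $n\ge 1$, $F(X,n)=\{(x_1,\dots,x_n)\in X^{\times n}\mid x_i\neq x_j \text{ for } i\neq j\}$, with the subspace topology from the Cartesian product $X^{\times n}=X\times\dots\times X$ ($n$ factors). Let $X$ be a path-connected topological space with the homotopy type of a finite CW-complex. Let $PX$ be the space of all continuous paths $\gamma\colon[0,1]\to X$ with the compact-open topology, and let $\pi\colon PX\to X\times X$ be the fibration $\pi(\gamma)=(\gamma(0),\gamma(1))$. The topological complexity $\mathsf{TC}(X)$ is the smallest positive integer $k$ for which $X\times X=U_1\cup\dots\cup U_k$, where each $U_i$ is open and there exists a continuous map $s_i\colon U_i\to PX$ with $\pi\circ s_i=\mathrm{id}_{U_i}$ for $1\le i\le k$ (unreduced normalization: $\mathsf{TC}$ of a point is $1$). *)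

(* Defs.v *)
From HB Require Import structures.
From mathcomp Require Import all_boot all_order all_algebra.
From mathcomp Require Import all_classical all_reals all_analysis.
Import Order.TTheory GRing.Theory Num.Theory.
Import numFieldTopology.Exports.

Set Implicit Arguments.
Unset Strict Implicit.
Unset Printing Implicit Defensive.

Local Open Scope classical_set_scope.
Local Open Scope ring_scope.

(* A set [A] used as a type is [set_type A], with the subspace topology. *)

Definition unit_interval (R : realType) : set R := `[0, 1].
Arguments unit_interval : clear implicits.

Lemma unit_interval0 (R : realType) : (0 : R) \in unit_interval R.
Proof. by apply/mem_set; rewrite /unit_interval /= in_itv /= lexx ler01. Qed.

Lemma unit_interval1 (R : realType) : (1 : R) \in unit_interval R.
Proof. by apply/mem_set; rewrite /unit_interval /= in_itv /= ler01 lexx. Qed.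

Definition I0 (R : realType) : unit_interval R := exist _ 0 (@unit_interval0 R).
Definition I1 (R : realType) : unit_interval R := exist _ 1 (@unit_interval1 R).
Arguments I0 : clear implicits.
Arguments I1 : clear implicits.

(* A wrapper, because [continuousType] carries other function-space
   topologies in some modules of the library. *)
Definition path_space (R : realType) (X : topologicalType) : Type :=
  continuousType (unit_interval R) X.

HB.instance Definition _ (R : realType) (X : topologicalType) :=
  Choice.copy (path_space R X) (continuousType (unit_interval R) X).

HB.instance Definition _ (R : realType) (X : topologicalType) :=
  Topological.copy (path_space R X)
    (initial_topology
      (fun g : path_space R X => (g : {compact-open, unit_interval R -> X}))).

Definition endpoints (R : realType) (X : topologicalType)
    (g : path_space R X) : X * X :=
  ((g : unit_interval R -> X) (I0 R), (g : unit_interval R -> X) (I1 R)).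

Definition has_motion_planners (R : realType) (X : topologicalType) (k : nat) :=
  exists U : 'I_k -> set (X * X),
    \bigcup_i U i = setT /\
    forall i, open (U i) /\
      exists s : U i -> path_space R X,
        continuous s /\ forall u : U i, endpoints (s u) = \val u.

(* Topological complexity, unreduced. The value 0 stands for the case where no
   finite [k] works; it is never attained otherwise. *)
Definition TC (R : realType) (X : topologicalType) : nat :=
  xget 0%N [set k | [/\ (0 < k)%N, has_motion_planners R X k &
    forall j, (0 < j)%N -> has_motion_planners R X j -> (k <= j)%N]].

Definition config_set (X : topologicalType) (n : nat) : set {ptws 'I_n -> X} :=
  [set x | forall i j : 'I_n, i != j -> x i <> x j].
Arguments config_set : clear implicits.

Definition config_space (X : topologicalType) (n : nat) : topologicalType :=
  config_set X n : Type.

Definition sphere2 (R : realType) : set 'rV[R]_3 :=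
  [set x | \sum_(i < 3) x 0 i ^+ 2 = 1].
Arguments sphere2 : clear implicits.

Definition punctured_sphere (R : realType) (Q : set 'rV[R]_3) :
    topologicalType :=
  sphere2 R `\` Q : Type.

(* Main.v *)
(** Stereographic projection from a puncture turns the space into the configurations of
    [n] points of the plane avoiding [m - 1] punctures.

    Lower bound.  Take two tori in the configuration space: points revolving around a
    puncture on nested circles, with the radii increasing for the first torus and
    decreasing for the second one.  A motion planner on an open set [U] is a homotopy
    over [U] between the two tori, so the winding numbers of [x_j - x_i] and of
    [x_j - p] (for a puncture [p]) along any loop of the product torus [T^N] contained
    in [U] agree for both; these equations force the class of the loop to vanish.  But
    if [T^N] is covered by [N] open sets, one of them contains a homotopically non
    trivial loop: colour a fine grid of a large cube of the universal cover by the open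
    sets, apply the [N]-dimensional Hex theorem and the pigeonhole principle.  The
    dimension [N] is [2n - 3], [2n - 1], [2n] for [m = 1], [m = 2], [m >= 3].

    Upper bound.  Order the points and the punctures by the real part (after a generic
    shear) and, for equal real parts, by the imaginary part.  The order types stratify
    the space by convex cells, of codimension the number of coincidences of real parts,
    and a cell has a convex open neighbourhood defined by the same strict inequalities.
    In the square of the space the cells of codimension [c] have disjoint open
    neighbourhoods, on which one moves linearly to a base point; [c] ranges over
    [0..2n].  For [m <= 2] one normalizes two of the points of the configuration
    (including the puncture) to [0] and [1], which splits off a factor [C^*] that needs
    only one more open set. *)

Require Import Defs.
From mathcomp Require Import all_boot all_order all_algebra all_fingroup.
From mathcomp Require Import all_classical all_reals all_analysis.
From mathcomp Require Import complex.
From mathcomp Require Import zify ring lra.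
Import Order.TTheory GRing.Theory Num.Theory.
Import numFieldTopology.Exports numFieldNormedType.Exports.

Set Implicit Arguments.
Unset Strict Implicit.
Unset Printing Implicit Defensive.

(** * A combinatorial form of the Lebesgue covering theorem *)

(** Multiplication by [t] pairs each even permutation with an odd one of the same value, so the
    terms cancel modulo 2. *)
Lemma big_addb_perm_even n (t : 'S_n) (F : 'S_n -> bool) :
  odd_perm t -> (forall s, F (s * t)%g = F s) ->
  \big[addb/false]_s F s = false.
Proof.
move=> odd_t Ft; rewrite (bigID (@odd_perm _)) /=.
rewrite (reindex_inj (mulIg t)) /=.
under eq_bigl do rewrite odd_permM odd_t addbT.
by under eq_bigr do rewrite Ft; rewrite addbb.
Qed.

Section KuhnTriangulation.
Variables (n K : nat).
Local Notation N := n.+1.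
Local Notation vertex := {ffun 'I_N -> nat}.
(** A label is a coordinate with a sign, as in Tucker's lemma; [true] stands for the positive
    sign. *)
Variable lab : vertex -> bool * 'I_N.

(* The vertices of the Kuhn simplex with origin [b] whose coordinates are
   incremented in the order of their ranks under [r]. *)
Definition kuhn_vertex (b : vertex) (r : 'S_N) (m : nat) : vertex :=
  [ffun i => b i + (r i < m)].

Definition full_facet b r k :=
  [forall i, exists m : 'I_N.+1,
    (m != k) && (lab (kuhn_vertex b r m) == (true, i))].

Definition full_bottom b r :=
  [forall i, exists m : 'I_N, lab (kuhn_vertex b r m) == (true, i)].

Definition kuhn_adj (v w : vertex) := [forall i, v i <= w i <= (v i).+1].

(** If the facet opposite to [k] carries all positive labels, the label of [k] cannot be negative,
    as its complement occurs in that facet. So it repeats the label of exactly one other vertex [m],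
    and the full facets are those opposite to [k] and to [m]. *)
Lemma full_facet_parity (l : 'I_N.+1 -> bool * 'I_N) :
  (forall m m' b i, l m = (b, i) -> l m' = (~~ b, i) -> False) ->
  \big[addb/false]_(k < N.+1)
    [forall i, exists m : 'I_N.+1, (m != k) && (l m == (true, i))] = false.
Proof.
move=> l_nc.
set D := fun k => [forall i, exists m : 'I_N.+1, (m != k) && (l m == (true, i))].
have [/existsP[k Dk]|] := boolP [exists k, D k]; last first.
  by rewrite negb_exists => /forallP nD; rewrite big1 // => k _; exact/negbTE/nD.
have [i lk] : exists i, l k = (true, i).
  case E: (l k) => [b i]; exists i; case: b E => // E.
  have /existsP[m /andP[_ /eqP lm]] := forallP Dk i.
  by case: (l_nc k m false i E lm).
have /existsP[m /andP[mk /eqP lm]] := forallP Dk i.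
have Dm : D m.
  apply/forallP => j; have /existsP[m' /andP[m'k lm']] := forallP Dk j.
  apply/existsP; have [m'm|m'm] := eqVneq m' m; last by exists m'; rewrite m'm.
  by exists k; rewrite eq_sym mk lk -lm -m'm.
rewrite (bigD1 k) //= (bigD1 m) //= -/(D k) -/(D m) Dk Dm big1 //.
move=> k' /andP[k'k k'm]; apply/negbTE/negP => /forallP Dk'.
(* The facet opposite to [k'] would contain both [k] and [m]. Its [N] vertices carry [N] different
   labels, so these two cannot share one. *)
pose g j := xchoose (existsP (Dk' j)).
have gP j : g j != k' /\ l (g j) = (true, j).
  by have /andP[? /eqP] := xchooseP (existsP (Dk' j)).
have g_inj : injective g.
  by move=> x y gxy; have := (gP x).2; rewrite gxy (gP y).2 => -[].
have gim : codom g =i [set~ k']%SET.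
  apply/subset_cardP; last first.
    by apply/fintype.subsetP => _ /codomP[j ->]; rewrite !finset.inE (gP j).1.
  by rewrite card_codom // card_ord cardsC1 card_ord.
have /codomP[a ka] : k \in codom g by rewrite gim !finset.inE eq_sym.
have /codomP[c mc] : m \in codom g by rewrite gim !finset.inE eq_sym.
have := (gP a).2; rewrite -ka lk => -[ia].
have := (gP c).2; rewrite -mc lm => -[ic].
by move: mk; rewrite ka mc -ia -ic eqxx.
Qed.

(** Exchanging the ranks [k - 1] and [k] alters only vertex [k], so the simplices of a given origin
    share their facets opposite to [k] in pairs. *)
Lemma full_facet_inner b (k : 'I_N.+1) : 0 < k < N ->
  \big[addb/false]_r full_facet b r k = false.
Proof.
move=> /andP[k0 kN].
have k1N : k.-1 < N by rewrite prednK // ltnW.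
pose t := tperm (Ordinal k1N) (Ordinal kN).
apply: (@big_addb_perm_even _ t).
  by rewrite odd_tperm -val_eqE /= -[X in _ != X]prednK // neq_ltn ltnSn.
move=> r; apply: eq_forallb => i; apply: eq_existsb => m.
case: (eqVneq m k) => //= mk; congr (lab _ == _).
apply/ffunP => j; rewrite !ffunE permM; congr (_ + _).
congr nat_of_bool.
have mk' : nat_of_ord m <> nat_of_ord k by apply/eqP.
rewrite /t; case: tpermP => [->|->|//] /=.
all: by case: (ltngtP k m) => [km|km|/esym //]; lia.
Qed.

Lemma full_facet_max b r : full_facet b r ord_max = full_bottom b r.
Proof.
apply: eq_forallb => i; apply/existsP/existsP => -[m].
  move=> /andP[mN lm]; have mN' : m < N by have := ltn_ord m; move: mN; rewrite -val_eqE /=; lia.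
  by exists (Ordinal mN').
move=> lm; exists (widen_ord (leqnSn N) m).
by rewrite lm andbT -val_eqE /= neq_ltn ltn_ord.
Qed.

Definition rank_pred : 'S_N := perm (bij_inj (@ord_pred_bij N)).

Definition incr_coord (b : vertex) (j : 'I_N) : vertex :=
  [ffun i => b i + (i == j)].

(** Without its first vertex, the simplex is the bottom of the one whose origin is the second
    vertex: the coordinate of rank 0 has been incremented and becomes the last, and the other ranks
    drop by one. *)
Lemma full_facet0 b r :
  full_facet b r ord0 = full_bottom (incr_coord b (r^-1%g ord0)) (r * rank_pred)%g.
Proof.
have vE (m : nat) : m < N -> kuhn_vertex b r m.+1 =
    kuhn_vertex (incr_coord b (r^-1%g ord0)) (r * rank_pred)%g m.
  move=> mN; apply/ffunP => i; rewrite !ffunE permM [rank_pred _]permE -addnA; congr (_ + _).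
  have -> : (i == r^-1%g ord0) = (val (r i) == 0).
    by rewrite -(inj_eq (@perm_inj _ r)) permKV.
  rewrite /=.
  have := ltn_ord (r i); case: (val (r i)) => [|x] xN.
    by rewrite modn_small //=; lia.
  by rewrite addSn /= modnDr modn_small //; lia.
apply: eq_forallb => i; apply/existsP/existsP => -[m].
  move=> /andP[m0 /eqP lm].
  have m1N : m.-1 < N by have := ltn_ord m; move: m0; rewrite -val_eqE /=; lia.
  exists (Ordinal m1N); rewrite -vE //= prednK ?lm //.
  by move: m0; rewrite -val_eqE /=; lia.
move=> lm; exists (lift ord0 m).
by rewrite -val_eqE /= /bump /= add1n vE.
Qed.

Hypothesis K_ge2 : 1 < K.

Definition on_bd (v : vertex) (i : 'I_N) := (v i == 0) || (v i == K).

(** On the boundary of the cube [[0, K]^N] the label is the first coordinate lying in a face,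
    positive on the face 0 and negative on the face [K]. *)
Hypothesis lab_bd : forall v i,
  on_bd v i -> (forall i' : 'I_N, i' < i -> ~~ on_bd v i') -> lab v = (v i == 0, i).

Hypothesis lab_compl : forall (v w : vertex) b i, (forall j, v j <= K) -> (forall j, w j <= K) ->
  kuhn_adj v w || kuhn_adj w v -> lab v = (b, i) -> lab w = (~~ b, i) -> False.

Local Notation box := {ffun 'I_N -> 'I_K}.
Definition of_box (b : box) : vertex := [ffun i => b i : nat].

Lemma kuhn_vertex_adj b r m m' : m <= m' ->
  kuhn_adj (kuhn_vertex b r m) (kuhn_vertex b r m').
Proof. by move=> mm'; apply/forallP => i; rewrite !ffunE; lia. Qed.

Lemma simplex_parity (b : box) r :
  \big[addb/false]_(k < N.+1) full_facet (of_box b) r k = false.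
Proof.
apply: (full_facet_parity (l := fun m => lab (kuhn_vertex (of_box b) r m))).
move=> m m' c i.
have le_K k j : kuhn_vertex (of_box b) r k j <= K.
  by rewrite !ffunE; have := ltn_ord (b j); lia.
apply: lab_compl => //.
by case: (leqP m m') => [|/ltnW] h; rewrite ?(kuhn_vertex_adj _ _ h) ?orbT.
Qed.

Lemma lab_bdP v b i i0 : on_bd v i0 -> lab v = (b, i) ->
  [/\ on_bd v i, b = (v i == 0) & forall i' : 'I_N, i' < i -> ~~ on_bd v i'].
Proof.
move=> bd0; pose P (i : 'I_N) := on_bd v i.
have [j bdj jmin] := @arg_minnP _ i0 P (fun i => i) bd0.
rewrite (lab_bd bdj); last first.
  by move=> i' i'j; apply/negP => /jmin; rewrite leqNgt i'j.
move=> [<- <-]; split=> // i' i'j; apply/negP => /jmin; rewrite leqNgt i'j //.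
Qed.

Lemma full_bottom_top (b : vertex) (r : 'S_N) :
  b (r^-1%g ord_max) = K -> full_bottom b r = false.
Proof.
set j := r^-1%g ord_max => bj; apply/negbTE/negP => /forallP /(_ j) /existsP[m].
have vj : kuhn_vertex b r m j = K.
  by rewrite !ffunE permKV bj /= ltnNge -ltnS ltn_ord addn0.
have bd : on_bd (kuhn_vertex b r m) j by rewrite /on_bd vj eqxx orbT.
move=> /eqP /(lab_bdP bd)[_ + _]; rewrite vj; case: K K_ge2 => //.
Qed.

Lemma perm_mono_id (r : 'S_N) :
  (forall i j : 'I_N, i < j -> r i < r j) -> r = 1%g.
Proof.
have ge_id (s : 'S_N) : (forall i j : 'I_N, i < j -> s i < s j) -> forall i : 'I_N, i <= s i.
  move=> sm [i +]; elim: i => // i IH iN /=.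
  have iN' : i < N by exact: ltnW.
  exact: leq_ltn_trans (IH iN') (sm (Ordinal iN') (Ordinal iN) (ltnSn i)).
move=> rm; apply/permP => i; rewrite perm1; apply/val_inj/eqP => /=.
rewrite eqn_leq ge_id // andbT.
have := ge_id r^-1%g _ (r i); rewrite permK; apply.
move=> x y xy; rewrite ltnNge; apply/negP; rewrite leq_eqVlt => /orP[/eqP/val_inj/perm_inj|/rm].
  by move=> yx; rewrite yx ltnn in xy.
by rewrite !permKV ltnNge (ltnW xy).
Qed.

(** The facet lies in a face at 0, so its labels are prescribed. A vertex labelled [(true, i)] has
    coordinate [i] still 0 and all earlier ones nonzero; hence the origin is 0 and coordinates are
    incremented in their natural order. *)
Lemma full_bottom0P (b : vertex) (r : 'S_N) :
  (forall i, b i < K) -> b (r^-1%g ord_max) = 0 ->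
  full_bottom b r = (b == [ffun=> 0]) && (r == 1%g).
Proof.
set j := r^-1%g ord_max => bK bj; apply/idP/idP; last first.
  move=> /andP[/eqP -> /eqP ->]; apply/forallP => i; apply/existsP; exists i.
  (* Vertex [i] has ones before coordinate [i] and zeros from it on; a coordinate equal to one is in
     no face because [1 < K]. *)
  have vE i' : kuhn_vertex [ffun=> 0] 1 i i' = (i' < i) by rewrite !ffunE perm1.
  apply/eqP; rewrite (@lab_bd _ i) ?vE ?ltnn //.
    by rewrite /on_bd vE ltnn eqxx.
  by move=> i' i'i; rewrite /on_bd vE i'i; case: K K_ge2 => [|[]].
move=> /forallP T.
have vj m : m < N -> kuhn_vertex b r m j = 0.
  by move=> mN; rewrite !ffunE permKV bj /= ltnNge -ltnS mN.
have H i : exists2 m, m < N & [/\ b i = 0, r i >= m &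
    forall i' : 'I_N, i' < i -> kuhn_vertex b r m i' != 0].
  have /existsP[m /eqP lm] := T i; exists m => //.
  have bd : on_bd (kuhn_vertex b r m) j by rewrite /on_bd vj ?eqxx.
  have [_ /esym v0 vi'] := lab_bdP bd lm; move: v0; rewrite !ffunE addn_eq0.
  move=> /andP[/eqP -> rim]; split => //; first by rewrite leqNgt; case: ltnP rim.
  by move=> i' /vi'; apply: contra => /eqP v0; rewrite /on_bd v0 eqxx.
have b0 i : b i = 0 by have [m _ []] := H i.
apply/andP; split; first by apply/eqP/ffunP => i; rewrite b0 ffunE.
apply/eqP/perm_mono_id => i' i i'i; have [m _ [_ mi /(_ _ i'i)]] := H i.
by rewrite ffunE b0 /=; case: ltnP => // rm _; exact: leq_trans mi.
Qed.

(* Each simplex has an even number of full facets.  Modulo 2, in the sum over all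
   simplices, the facets other than the first and the last cancel by a transposition of
   ranks, and the first facet of a simplex is the last one of a neighbour; what remains
   lies on the boundary of the box, where exactly one facet is full. *)
Lemma labelling_absurd : False.
Proof.
have tot : \big[addb/false]_(b : box) \big[addb/false]_(r : 'S_N)
    \big[addb/false]_(k < N.+1) full_facet (of_box b) r k = false.
  by rewrite big1 // => b _; rewrite big1 // => r _; exact: simplex_parity.
have sumE (b : box) : \big[addb/false]_(r : 'S_N)
    \big[addb/false]_(k < N.+1) full_facet (of_box b) r k =
  \big[addb/false]_(r : 'S_N) (full_bottom (incr_coord (of_box b) (r^-1%g ord_max)) r
                      (+) full_bottom (of_box b) r).
  rewrite exchange_big /= big_ord_recl big_ord_recr /= [X in _ (+) (X (+) _)]big1 => [|k _]; last first.
    by apply: full_facet_inner; have := ltn_ord k; rewrite /= /bump /=; lia.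
  rewrite big_split /=; congr addb; last first.
    apply: eq_bigr => r _; rewrite -[RHS]full_facet_max; congr full_facet.
    exact: val_inj.
  rewrite [RHS](reindex_inj (mulIg rank_pred)) /=; apply: eq_bigr => r _.
  rewrite full_facet0.
  suff -> : r^-1%g ord0 = (r * rank_pred)^-1%g ord_max :> 'I_N by [].
  apply: (@perm_inj _ (r * rank_pred)%g); rewrite permKV permM permKV permE.
  by apply: val_inj; rewrite /= modn_small.
move: tot; under eq_bigr do rewrite sumE.
rewrite exchange_big /=.
have tele (r : 'S_N) : \big[addb/false]_(b : box)
    (full_bottom (incr_coord (of_box b) (r^-1%g ord_max)) r (+) full_bottom (of_box b) r) =
  \big[addb/false]_(b : box) ((b == [ffun=> Ordinal (ltnW K_ge2)]) && (r == 1%g)).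
  set j := r^-1%g ord_max.
  (* Translation by one along [j], made cyclic. It agrees with [incr_coord] except at the
     wrap-around, where the term vanishes by [full_bottom_top]. *)
  pose sh (b : box) : box := [ffun i => if i == j then ordS (b i) else b i].
  have sh_inj : injective sh.
    move=> b b' /ffunP e; apply/ffunP => i; have := e i; rewrite !ffunE.
    by case: ifP => // _; exact: (bij_inj (@ordS_bij K)).
  rewrite big_split /=.
  have -> : \big[addb/false]_(b : box) full_bottom (incr_coord (of_box b) j) r =
      \big[addb/false]_(b : box) ((val (b j) != 0) && full_bottom (of_box b) r).
    rewrite [RHS](reindex_inj sh_inj) /=; apply: eq_bigr => b _.
    rewrite ffunE eqxx /=.
    have := ltn_ord (b j); rewrite leq_eqVlt => /predU1P[bK|bK].
      rewrite bK modnn /= full_bottom_top //.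
      by rewrite !ffunE eqxx addn1 bK.
    rewrite modn_small //=; congr (full_bottom _ r).
    apply/ffunP => i; rewrite !ffunE; case: eqVneq => [->|_] /=; last by rewrite addn0.
    by rewrite modn_small // addn1.
  rewrite -big_split /=; apply: eq_bigr => b _.
  have [bj|bj] := eqVneq (val (b j)) 0; last first.
    rewrite addbb; apply/esym/negbTE; rewrite negb_and; apply/orP; left.
    by apply: contra bj => /eqP ->; rewrite ffunE.
  rewrite addFb full_bottom0P; last by rewrite ffunE.
    congr andb; apply/eqP/eqP => [/ffunP e|->].
      by apply/ffunP => i; apply: val_inj; have := e i; rewrite !ffunE.
    by apply/ffunP => i; rewrite !ffunE.
  by move=> i; rewrite ffunE.
under eq_bigr do rewrite tele.
rewrite (bigD1 1%g) //= [X in _ (+) X]big1 => [|r /negbTE ->]; last first.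
  by rewrite big1 // => b _; rewrite andbF.
rewrite (bigD1 [ffun=> Ordinal (ltnW K_ge2)]) //= eqxx eqxx big1 //.
by move=> b /negbTE ->.
Qed.

End KuhnTriangulation.

(** * The Hex theorem in dimension [n.+1] *)

Section Hex.
Variables (n L : nat) (c : {ffun 'I_n.+1 -> 'I_L.+1} -> 'I_n.+1).

Definition mono_adj : rel {ffun 'I_n.+1 -> 'I_L.+1} := fun p q =>
  (c p == c q) && [forall k, (p k <= (q k).+1) && (q k <= (p k).+1)].

Lemma mono_adj_sym : symmetric mono_adj.
Proof.
by move=> p q; rewrite /mono_adj eq_sym; congr andb; apply: eq_forallb => k; rewrite andbC.
Qed.

(** If no monochromatic component joins opposite faces, surround the grid by one more layer,
    labelled as a boundary, and label each cell by its colour, with a sign telling whether its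
    component reaches the face 0 in the direction of that colour. Neighbours never have
    complementary labels, which contradicts [labelling_absurd]. *)
Lemma hex : exists i p q,
  [/\ connect mono_adj p q, p i = ord0 & q i = ord_max].
Proof.
case: (boolP [exists i, exists p, exists q, [&& connect mono_adj p q, p i == ord0 & q i == ord_max]]).
  by move=> /existsP[i /existsP[p /existsP[q /and3P[? /eqP ? /eqP ?]]]]; exists i, p, q.
move=> noP; exfalso.
have nocross i p q : connect mono_adj p q -> p i = ord0 -> q i = ord_max -> False.
  move=> pq pi qi; move/negP: noP; apply; apply/existsP; exists i.
  by apply/existsP; exists p; apply/existsP; exists q; rewrite pq pi qi !eqxx.
(* The grid coordinates [0..L] are shifted to [1..L + 1]; the added layer has a coordinate equal to
   0 or [K]. *)
pose V := {ffun 'I_n.+1 -> nat}; pose K := L.+2.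
pose bd (v : V) (i : 'I_n.+1) := (v i == 0) || (v i == K).
pose inner (v : V) : {ffun 'I_n.+1 -> 'I_L.+1} := [ffun i => inord (v i).-1].
pose touch p := [exists q, connect mono_adj p q && (q (c p) == ord0)].
pose lab (v : V) := if [pick i | bd v i & [forall i' : 'I_n.+1, (i' < i) ==> ~~ bd v i']] is Some i
  then (v i == 0, i) else (touch (inner v), c (inner v)).
have labP (v : V) : (forall j, v j <= K) ->
    (exists2 i, lab v = (v i == 0, i) & bd v i) \/
    ([/\ lab v = (touch (inner v), c (inner v)) & forall i, (inner v i).+1 = v i]).
  move=> vK; rewrite /lab; case: pickP => [i /andP[bi _]|nobd]; first by left; exists i.
  right; split => // i.
  have nbd j : ~~ bd v j.
    apply/negP => bj.
    have [i1 b1 min1] := @arg_minnP _ j (bd v) (fun i => i) bj.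
    have := nobd i1; rewrite b1 /= => /negbT/negP; apply.
    apply/forallP => i'; apply/implyP => lt; apply/negP => /min1; by rewrite leqNgt lt.
  have := nbd i; rewrite /bd negb_or ffunE => /andP[v0 vKi].
  rewrite inordK; first by rewrite prednK // lt0n.
  by have := vK i; rewrite /K in vKi *; lia.
apply: (@labelling_absurd n K lab) => //.
  move=> v i bi bmin; rewrite /lab; case: pickP => [j /andP[bj /forallP jmin]|/(_ i)]; last first.
    rewrite /bd -/(on_bd K v i) bi /= => /negbT/negP; case.
    by apply/forallP => i'; apply/implyP => /bmin.
  suff -> : j = i by [].
  apply/val_inj/eqP => /=; rewrite eqn_leq; apply/andP; split; rewrite leqNgt.
    by apply/negP => ij; have := jmin i; rewrite ij /= /bd -/(on_bd K v i) bi.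
  by apply/negP => /bmin; rewrite /on_bd -/(bd v j) bj.
have key (v w : V) i : (forall j, v j <= K) -> (forall j, w j <= K) ->
    (forall j, (v j <= (w j).+1) && (w j <= (v j).+1)) ->
    lab v = (true, i) -> lab w = (false, i) -> False.
  move=> vK wK vw.
  (* The four cases: 0 and [K] are too far apart; a cell next to the face 0 touches it; a touching
     component next to the face [K] would cross; adjacent cells of one colour share their
     component. *)
  case: (labP v vK) => [[i1 -> bi1]|[-> vE]]; case: (labP w wK) => [[i2 -> bi2]|[-> wE]].
  - move=> [/eqP v0 e1] [w0 e2]; move: v0 w0 bi2; subst => v0 w0.
    rewrite /bd w0 /= => /eqP w2; have := vw i; rewrite v0 w2; lia.
  - move=> [/eqP v0 e1] [tw ew]; subst i1; move/negbT/negP: tw; apply; apply/existsP.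
    exists (inner w); rewrite connect0 ew; apply/eqP/val_inj => /=.
    by have := vw i; have := wE i; rewrite v0; lia.
  - move=> [/existsP[q /andP[vq /eqP q0]] ev] [/eqP w0 e2]; subst i2.
    have wi : w i = K by move: bi2; rewrite /bd => /orP[/eqP|/eqP].
    rewrite ev in q0; apply: (nocross i q (inner v)) => //.
      by rewrite (sym_connect_sym mono_adj_sym).
    apply/val_inj => /=; have := vw i; have := vE i; rewrite wi.
    by have := ltn_ord (inner v i); rewrite /K; lia.
  - move=> [/existsP[q /andP[vq /eqP q0]] ev] [/negbT/negP tw ew]; apply: tw.
    apply/existsP; exists q; rewrite ew -ev q0 eqxx andbT.
    apply: connect_trans vq; apply: connect1; rewrite /mono_adj ev ew eqxx /=.
    apply/forallP => k; have := vw k; have := vE k; have := wE k; lia.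
move=> v w b i vK wK adj lv lw.
have vw j : (v j <= (w j).+1) && (w j <= (v j).+1).
  by case/orP: adj => /forallP /(_ j); lia.
have wv j : (w j <= (v j).+1) && (v j <= (w j).+1) by rewrite andbC.
by case: b lv lw => lv lw; [exact: (key v w i)|exact: (key w v i)].
Qed.

End Hex.

Local Open Scope classical_set_scope.
Local Open Scope ring_scope.

(** * Discrete winding angles *)

Section Angle.
Variable R : realType.
Local Notation C := R[i].
Local Notation Re := (@complex.Re R).
Local Notation Im := (@complex.Im R).
Local Notation normc := (@Normc.normc R).

Definition expi (t : R) : C := (cos t +i* sin t)%C.

Lemma expiD s t : expi (s + t) = expi s * expi t.
Proof. by rewrite /expi cosD sinD; apply/eqP; rewrite eq_complex /=; apply/andP; split; apply/eqP; ring. Qed.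

Lemma expi0 : expi 0 = 1.
Proof. by rewrite /expi cos0 sin0. Qed.

Lemma expi_neq0 t : expi t != 0.
Proof.
apply/eqP => t0; have := expiD t (- t); rewrite subrr t0 mul0r expi0 => /eqP.
by rewrite oner_eq0.
Qed.

Lemma normc_expi t : normc (expi t) = 1.
Proof. by rewrite /= cos2Dsin2 sqrtr1. Qed.

Lemma cos_eq1 (x : R) : `|x| < pi *+ 2 -> cos x = 1 -> x = 0.
Proof.
wlog x0 : x / 0 <= x.
  move=> H xpi cx; case: (leP 0 x) => [x0|/ltW x0]; first exact: H.
  by apply/eqP; rewrite -oppr_eq0; apply/eqP/H; rewrite ?normrN ?cosN ?oppr_ge0.
rewrite ger0_norm // => xpi cx.
have [//|xN0] := eqVneq x 0.
have xhalf : x = (x / 2) *+ 2 by rewrite mulr2n -splitr.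
have : 0 < sin (x / 2).
  apply: sin_gt0_pi; rewrite ltr_pdivrMr // mulr_natr xpi andbT.
  by rewrite divr_gt0 // lt0r xN0.
move=> s0.
have c1 := cos_mulr2n (x / 2); rewrite -xhalf cx in c1.
have c2 := cos2Dsin2 (x / 2).
have : sin (x / 2) ^+ 2 = 0 by move: c1 c2; rewrite mulr2n; lra.
by move/eqP; rewrite expf_eq0 /= (gt_eqF s0).
Qed.

(** For nonzero [z], the real number [t] is some argument of [u / z], not necessarily the principal
    one. *)
Definition dir (z u : C) (t : R) := exists2 r : R, 0 < r & u = r%:C%C * z * expi t.

Lemma dir_inj z u s t : z != 0 -> dir z u s -> dir z u t ->
  `|s - t| < pi *+ 2 -> s = t.
Proof.
move=> z0 [r r0 ur] [q q0 uq] st; apply/eqP; rewrite -subr_eq0; apply/eqP.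
apply: cos_eq1 => //.
have : r%:C%C * expi s = q%:C%C * expi t.
  by apply: (mulIf z0); rewrite mulrAC -ur uq mulrAC.
have -> : expi s = expi (s - t) * expi t by rewrite -expiD subrK.
rewrite mulrA => /(mulIf (expi_neq0 _)); set x := s - t => /eqP.
rewrite eq_complex /= !mul0r !subr0 !addr0 => /andP[/eqP rc].
rewrite mulf_eq0 (gt_eqF r0) /= => /eqP s0.
have := cos2Dsin2 x; rewrite s0 expr0n addr0 => /eqP.
rewrite sqrf_eq1 => /orP[/eqP//|/eqP c1].
by move: rc; rewrite c1; lra.
Qed.

(** The argument of [v / u] is less than [pi / 4] in absolute value. The bound is small enough for
    comparing sums of a few such angles without an ambiguity of [2 pi]. *)
Definition good (u v : C) := `|Im (u^*%C * v)| < Re (u^*%C * v).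

Definition ang (u v : C) := atan (Im (u^*%C * v) / Re (u^*%C * v)).

Lemma good_Re_gt0 u v : good u v -> 0 < Re (u^*%C * v).
Proof. exact: le_lt_trans. Qed.

Lemma good_neq0 u v : good u v -> u != 0.
Proof.
move=> /good_Re_gt0 H; apply/eqP => u0; move: H.
by rewrite u0 conjc0 mul0r ltxx.
Qed.

Lemma good_sym u v : good u v -> good v u.
Proof.
rewrite /good; case: u => a b; case: v => c d /=.
rewrite -normrN; have -> : - (a * d + - b * c) = c * b + - d * a by ring.
by have -> : a * c - - b * d = c * a - - d * b by ring.
Qed.

Lemma good_scale (r : R) u v : 0 < r -> good (r%:C%C * u) v -> good u v.
Proof.
move=> r0; rewrite /good.
case: u => a b; case: v => c d /=.
have -> : (r * a - 0 * b) * d + - (r * b + 0 * a) * c = r * (a * d + - b * c) by ring.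
have -> : (r * a - 0 * b) * c - - (r * b + 0 * a) * d = r * (a * c - - b * d) by ring.
by rewrite normrM gtr0_norm // ltr_pM2l.
Qed.

Lemma lt_ang u v : good u v -> `|ang u v| < pi / 4%:R.
Proof.
move=> g; have d0 := good_Re_gt0 g; rewrite /ang -atan1.
rewrite ltr_norml -atanN; apply/andP; split; apply: lt_atan.
  rewrite ltr_pdivlMr //; move: g; rewrite /good ltr_norml; lra.
rewrite ltr_pdivrMr //; move: g; rewrite /good ltr_norml; lra.
Qed.

Lemma dir_ang z u v t : dir z u t -> good u v -> dir z v (t + ang u v).
Proof.
move=> [r r0 uE] g; have d0 := good_Re_gt0 g; have u0 := good_neq0 g.
set a := ang u v.
have ca : 0 < cos a.
  by apply: cos_gt0_pihalf; rewrite /a /ang atan_gtNpi2 atan_ltpi2.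
have [rho rho0 wE] : exists2 rho, 0 < rho & u^*%C * v = rho%:C%C * expi a.
  exists (Re (u^*%C * v) / cos a); first exact: divr_gt0.
  have ta : Im (u^*%C * v) = sin a / cos a * Re (u^*%C * v).
    by rewrite -[_ / cos a]/(tan a) /a /ang atanK divfK // gt_eqF.
  apply/eqP; rewrite eq_complex; apply/andP; split; apply/eqP; move: ta.
    by rewrite /=; move=> _; field; rewrite gt_eqF.
  by move=> ->; rewrite /=; field; rewrite gt_eqF.
pose n2 : R := (Re u) ^+ 2 + (Im u) ^+ 2.
have n2E : n2%:C%C = u^*%C * u.
  rewrite /n2; case: (u) => x y; apply/eqP.
  by rewrite eq_complex /=; apply/andP; split; apply/eqP; ring.
have n20 : 0 < n2.
  have : n2 != 0.
    by apply: contra_neq u0 => n0; move/eqP: n2E; rewrite n0 eq_sym mulf_eq0 conjc_eq0 => /orP[]/eqP.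
  by rewrite lt0r => ->; rewrite addr_ge0 ?sqr_ge0.
exists (r * rho / n2); first by rewrite divr_gt0 // mulr_gt0.
rewrite expiD -[LHS](mulKf (_ : n2%:C%C != 0)); last first.
  by rewrite -[0]/((0:R)%:C%C) (inj_eq (@complexI _)) gt_eqF.
have -> : n2%:C%C * v = u * (u^*%C * v) by rewrite n2E; ring.
rewrite wE {1}uE !(rmorphM, fmorphV); ring.
Qed.

Lemma dir_refl z : dir z z 0.
Proof. by exists 1; rewrite ?ltr01 // expi0 mul1r mulr1. Qed.

(** Both sides are arguments of [v' / u], and they differ by less than four times [pi / 4]. *)
Lemma ang_quad u u' v v' : good u u' -> good u' v' -> good u v -> good v v' ->
  ang u u' + ang u' v' = ang u v + ang v v'.
Proof.
move=> g1 g2 g3 g4.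
have d1 := dir_ang (dir_ang (dir_refl u) g1) g2.
have d2 := dir_ang (dir_ang (dir_refl u) g3) g4.
have := dir_inj (good_neq0 g1) d1 d2; rewrite !add0r; apply.
have pi0 := pi_gt0 R.
have := lt_ang g1; have := lt_ang g2; have := lt_ang g3; have := lt_ang g4.
rewrite !ltr_norml mulr2n; lra.
Qed.

(** Both sides are arguments of [v / z], and they differ by less than [pi + 3 pi / 4], which is
    below [2 pi]. *)
Lemma ang_lift z x y u v : good (z * expi x) u -> good (z * expi y) v -> good u v ->
  `|y - x| <= pi -> y + ang (z * expi y) v = x + ang (z * expi x) u + ang u v.
Proof.
move=> gx gy guv xy.
have z0 : z != 0 by apply: contraTneq (good_neq0 gx) => ->; rewrite mul0r eqxx.
have dir_expi t : dir z (z * expi t) t by exists 1; rewrite ?ltr01 // mul1r.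
have d1 := dir_ang (dir_expi y) gy.
have d2 := dir_ang (dir_ang (dir_expi x) gx) guv.
apply: (dir_inj z0 d1 d2).
have pi0 := pi_gt0 R.
move: xy (lt_ang gx) (lt_ang gy) (lt_ang guv).
rewrite ler_norml !ltr_norml mulr2n; lra.
Qed.

Lemma expiD2pi x (m : nat) : expi (x + pi *+ 2 * m%:R) = expi x.
Proof.
elim: m => [|m IH]; first by rewrite mulr0 addr0.
by rewrite -natr1 mulrDr mulr1 addrA /expi cosD2pi sinD2pi -/(expi _) IH.
Qed.

(** A disc whose radius is half the modulus of its centre is seen from 0 within [pi / 6] of the
    direction of the centre. *)
Lemma good_near u v : normc (v - u) * 2 < normc u -> good u v.
Proof.
move=> uv.
pose w := u^*%C * (v - u).
have wn : normc w * 2 < normc u ^+ 2.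
  have u0 : 0 < normc u.
    by apply: le_lt_trans uv; rewrite mulr_ge0 //; case: (v - u) => ? ? /=; exact: sqrtr_ge0.
  have -> : normc w = normc u * normc (v - u).
    rewrite /w Normc.normcM; congr (_ * _).
    by case: (u) => x y /=; rewrite sqrrN.
  by rewrite -mulrA expr2 ltr_pM2l.
have wE : u^*%C * v = (normc u ^+ 2)%:C%C + w.
  rewrite /w mulrBr addrCA -[LHS]addr0; congr (_ + _); apply/esym/eqP; rewrite subr_eq0; apply/eqP.
  case: (u) => x y /=; rewrite sqr_sqrtr ?addr_ge0 ?sqr_ge0 //; apply/eqP.
  by rewrite eq_complex /=; apply/andP; split; apply/eqP; ring.
rewrite /good wE; move: wn; set N := normc u ^+ 2.
case: w {wE} => x y /= wn.
have hx : `|x| <= Num.sqrt (x ^+ 2 + y ^+ 2).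
  by rewrite -sqrtr_sqr ler_sqrt ?lerDl ?sqr_ge0 // addr_ge0 ?sqr_ge0.
have hy : `|y| <= Num.sqrt (x ^+ 2 + y ^+ 2).
  by rewrite -sqrtr_sqr ler_sqrt ?lerDr ?sqr_ge0 // addr_ge0 ?sqr_ge0.
rewrite add0r; move: hx hy wn; set s := Num.sqrt _.
rewrite !ler_norml !ltr_norml => /andP[? ?] /andP[? ?] ?; apply/andP; split; lra.
Qed.

End Angle.

(** * Motion planners as homotopies *)

Lemma continuous_pair (T U V : topologicalType) (f : T -> U) (g : T -> V) x :
  {for x, continuous f} -> {for x, continuous g} ->
  {for x, continuous (fun y => (f y, g y))}.
Proof.
by move=> cf cg; apply: (@cvg_pair _ _ _ (nbhs x) (nbhs (f x)) (nbhs (g x))).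
Qed.

Section UnitInterval.
Variable R : realType.

Lemma iproj_subproof (x : R) : Num.max 0 (Num.min x 1) \in unit_interval R.
Proof.
apply/mem_set; rewrite /unit_interval /= in_itv /= le_max lexx /=.
by rewrite ge_max ler01 /= ge_min lexx orbT.
Qed.

(** The retraction of the line onto the unit interval, which extends paths to all real times. *)
Definition iproj (x : R) : unit_interval R :=
  exist (fun y => y \in unit_interval R) _ (iproj_subproof x).

Lemma iprojE x : 0 <= x <= 1 -> \val (iproj x) = x.
Proof.
by move=> /andP[x0 x1] /=; rewrite (min_idPl x1) (max_idPr x0).
Qed.

Lemma unit_interval_bounds (t : unit_interval R) : 0 <= \val t <= 1.
Proof. by case: t => t /= /set_mem; rewrite /unit_interval /= in_itv. Qed.

Lemma iprojK (t : unit_interval R) : iproj (\val t) = t.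
Proof. by apply: val_inj; rewrite iprojE // unit_interval_bounds. Qed.

Lemma iproj0 : iproj 0 = I0 R.
Proof. by apply: val_inj; rewrite iprojE //= lexx ler01. Qed.

Lemma iproj1 : iproj 1 = I1 R.
Proof. by apply: val_inj; rewrite iprojE //= lexx ler01. Qed.

Lemma iproj_continuous : continuous iproj.
Proof.
apply: continuous_comp_initial => x.
have cmin : {for x, continuous ((id : R -> R^o) \min cst 1)}.
  by apply: continuous_min; [exact: cvg_id|exact: cst_continuous].
exact: (continuous_max (f := cst 0) (@cst_continuous _ _ _ _) cmin).
Qed.

Lemma unit_interval_compact : compact [set: unit_interval R].
Proof.
have -> : [set: unit_interval R] = iproj @` `[0, 1].
  apply/seteqP; split => // t _; exists (\val t); last exact: iprojK.
  by rewrite /= in_itv /= unit_interval_bounds.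
apply: continuous_compact; last exact: segment_compact.
exact/continuous_subspaceT/iproj_continuous.
Qed.

Lemma unit_interval_locally_compact : locally_compact [set: unit_interval R].
Proof.
move=> t _; rewrite withinET; exists setT; first exact: filterT.
by split; [exact: unit_interval_compact|exact: closedT].
Qed.

End UnitInterval.

Section Planners.
Variables (R : realType) (X : topologicalType).

(** A homotopy over [U] between the two projections. Time is real, and continuity is taken in the
    whole product at the points over [U] and [[0, 1]], which avoids subspace topologies. *)
Definition planner (U : set (X * X)) (h : (X * X) * R -> X) :=
  [/\ forall p t, U p -> 0 <= t <= 1 -> {for (p, t), continuous h},
      forall p, U p -> h (p, 0) = p.1 &
      forall p, U p -> h (p, 1) = p.2].

(** Currying a jointly continuous map gives a continuous map into the compact-open topology. *)
Lemma planner_section (U : set (X * X)) h : planner U h ->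
  exists s : U -> path_space R X, continuous s /\
    forall u : U, endpoints (s u) = \val u.
Proof.
move=> [hc h0 h1].
pose v (z : U * unit_interval R) : (X * X) * R := (\val z.1, \val z.2).
pose f := h \o v.
have fc : continuous f.
  move=> [u t].
  have c1 : {for (u, t), continuous (fun z : U * unit_interval R => \val z.1)}.
    apply: (@continuous_comp _ _ _ fst (fun x : U => \val x)); first exact: cvg_fst.
    exact: initial_continuous.
  have c2 : {for (u, t), continuous (fun z : U * unit_interval R => \val z.2)}.
    apply: (@continuous_comp _ _ _ snd (fun x : unit_interval R => \val x)); first exact: cvg_snd.
    exact: initial_continuous.
  apply: (@continuous_comp _ _ _ v h (u, t) (continuous_pair c1 c2)).
  apply: hc; last exact: unit_interval_bounds.
  exact: set_valP.
have [cf cfu] := continuous_curry fc.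
exists (fun u => mkcts (cfu u) : path_space R X); split; last first.
  move=> u; rewrite /endpoints /= /mkcts /curry /f /v /=.
  have Uu : U (\val u) by exact: set_valP.
  by rewrite h0 // h1 //; case: (\val u).
by apply: continuous_comp_initial => u; exact: cf.
Qed.

(** Uncurrying preserves continuity because the unit interval is locally compact and regular. *)
Lemma section_planner (U : set (X * X)) (s : U -> path_space R X) :
  open U -> continuous s -> (forall u : U, endpoints (s u) = \val u) ->
  exists h, planner U h.
Proof.
move=> oU sc se.
(* The value outside [U] is a default; since [U] is open, it does not affect continuity at the
   points of [U]. *)
pose h (z : (X * X) * R) := if pselect (U z.1) is left Up
  then (s (exist (fun p => p \in U) z.1 (mem_set Up)) : unit_interval R -> X) (iproj z.2) else z.1.1.
have hE p t (Up : p \in U) : h (p, t) =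
    (s (exist (fun p => p \in U) p Up) : unit_interval R -> X) (iproj t).
  rewrite /h /=; case: pselect => [Up'|/(_ (set_mem Up))//].
  by congr ((s _ : unit_interval R -> X) _); exact: val_inj.
have cs : continuous (uncurry (fun (u : U) (t : unit_interval R) =>
    (s u : unit_interval R -> X) t)).
  apply: continuous_uncurry_regular.
  - exact: unit_interval_locally_compact.
  - exact: uniform_regular.
  - move=> u; apply: (@continuous_comp _ _ _ s
      (fun g : path_space R X => (g : {compact-open, unit_interval R -> X}))).
      exact: sc.
    exact: initial_continuous.
  - by move=> u; exact: cts_fun.
exists h; split; last 2 first.
- move=> p Up; rewrite (hE _ _ (mem_set Up)) iproj0.
  by have /(congr1 fst) := se (exist (fun p => p \in U) p (mem_set Up)).
- move=> p Up; rewrite (hE _ _ (mem_set Up)) iproj1.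
  by have /(congr1 snd) := se (exist (fun p => p \in U) p (mem_set Up)).
move=> p t Up _; pose u0 : U := exist (fun p => p \in U) p (mem_set Up).
move=> O; rewrite (hE _ _ (mem_set Up)) => /= ON.
have [[A B] /= [[A' [[A'' oA'' <-] A''p] A'A] Bt] ABO] := cs (u0, iproj t) O ON.
exists (A'' `&` U, @iproj R @^-1` B).
  split => /=; last exact: iproj_continuous.
  by apply: open_nbhs_nbhs; split; [exact: openI|].
move=> [q x] /= [[A''q Uq] Bx].
rewrite (hE _ _ (mem_set Uq)).
apply: (ABO (exist (fun p => p \in U) q (mem_set Uq) : U, iproj x)); split => //=.
exact: A'A.
Qed.

End Planners.

(** * Continuity of complex-valued functions through real and imaginary parts *)

Section ComplexContinuity.
Variables (R : realType) (T : topologicalType).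
Local Notation C := R[i].
Local Notation Re := (@complex.Re R).
Local Notation Im := (@complex.Im R).

Definition cts_at (f : T -> C) (x : T) :=
  {for x, continuous (fun y => Re (f y))} /\
  {for x, continuous (fun y => Im (f y))}.

Lemma cts_at_cst c x : cts_at (fun=> c) x.
Proof. by split; exact: cst_continuous. Qed.

Lemma cts_atD f g x : cts_at f x -> cts_at g x -> cts_at (fun y => f y + g y) x.
Proof.
move=> [f1 f2] [g1 g2]; split.
- rewrite (_ : (fun y => _) = (fun y => Re (f y) + Re (g y))); first exact: cvgD.
  by apply/funext => y; case: (f y); case: (g y).
- rewrite (_ : (fun y => _) = (fun y => Im (f y) + Im (g y))); first exact: cvgD.
  by apply/funext => y; case: (f y); case: (g y).
Qed.

Lemma cts_atN f x : cts_at f x -> cts_at (fun y => - f y) x.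
Proof.
move=> [f1 f2]; split.
- rewrite (_ : (fun y => _) = (fun y => - Re (f y))); first exact: cvgN.
  by apply/funext => y; case: (f y).
- rewrite (_ : (fun y => _) = (fun y => - Im (f y))); first exact: cvgN.
  by apply/funext => y; case: (f y).
Qed.

Lemma cts_atB f g x : cts_at f x -> cts_at g x -> cts_at (fun y => f y - g y) x.
Proof. by move=> cf cg; apply: cts_atD => //; exact: cts_atN. Qed.

Lemma cts_atM f g x : cts_at f x -> cts_at g x -> cts_at (fun y => f y * g y) x.
Proof.
move=> [f1 f2] [g1 g2]; split.
- rewrite (_ : (fun y => _) = (fun y => Re (f y) * Re (g y) - Im (f y) * Im (g y))).
    by apply: cvgB; apply: cvgM.
  by apply/funext => y; case: (f y); case: (g y).
- rewrite (_ : (fun y => _) = (fun y => Re (f y) * Im (g y) + Im (f y) * Re (g y))).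
    by apply: cvgD; apply: cvgM.
  by apply/funext => y; case: (f y); case: (g y).
Qed.

Lemma normc2_neq0 (z : C) : z != 0 -> Re z ^+ 2 + Im z ^+ 2 != 0.
Proof.
apply: contra; rewrite paddr_eq0 ?sqr_ge0 // !sqrf_eq0 => /andP[/eqP h1 /eqP h2].
by rewrite eq_complex /= h1 h2 !eqxx.
Qed.

Lemma cts_atV f x : f x != 0 -> cts_at f x -> cts_at (fun y => (f y)^-1) x.
Proof.
move=> fx0 [f1 f2].
have n0 := normc2_neq0 fx0.
have cn : {for x, continuous (fun y => Re (f y) ^+ 2 + Im (f y) ^+ 2)}.
  by apply: cvgD; rewrite expr2; under eq_fun do rewrite expr2; apply: cvgM.
split.
- rewrite (_ : (fun y => _) = (fun y => Re (f y) / (Re (f y) ^+ 2 + Im (f y) ^+ 2))).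
    by apply: cvgM => //; apply: cvgV.
  by apply/funext => y; case: (f y).
- rewrite (_ : (fun y => _) = (fun y => - (Im (f y) / (Re (f y) ^+ 2 + Im (f y) ^+ 2)))).
    by apply: cvgN; apply: cvgM => //; apply: cvgV.
  by apply/funext => y; case: (f y) => a b /=; rewrite ?mulNr.
Qed.

Lemma cts_at_real (r : T -> R) x :
  {for x, continuous r} -> cts_at (fun y => (r y)%:C%C) x.
Proof. by move=> cr; split => //; exact: cst_continuous. Qed.

Lemma near_gt0 (r : T -> R) x : {for x, continuous r} -> 0 < r x ->
  \forall y \near x, 0 < r y.
Proof. by move=> cr r0; apply: (cr [set z | 0 < z]); exact: lt_nbhsr. Qed.

Lemma cts_at_neq0 f x : cts_at f x -> f x != 0 -> \forall y \near x, f y != 0.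
Proof.
move=> [f1 f2] fx0.
have cn : {for x, continuous (fun y => Re (f y) ^+ 2 + Im (f y) ^+ 2)}.
  by apply: cvgD; rewrite expr2; under eq_fun do rewrite expr2; apply: cvgM.
have n0 : 0 < Re (f x) ^+ 2 + Im (f x) ^+ 2.
  by rewrite lt0r normc2_neq0 // addr_ge0 // sqr_ge0.
near=> y; have : 0 < Re (f y) ^+ 2 + Im (f y) ^+ 2 by near: y; exact: near_gt0.
by apply: contraTneq => ->; rewrite /= !expr0n /= addr0 ltxx.
Unshelve. all: by end_near. Qed.

Lemma good_near_at (f g : T -> C) x : cts_at f x -> cts_at g x ->
  good (f x) (g x) -> \forall y \near x, good (f y) (g y).
Proof.
move=> [f1 f2] [g1 g2] gxx.
have E1 y : Re ((f y)^*%C * g y) = Re (f y) * Re (g y) + Im (f y) * Im (g y).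
  by case: (f y) => a b; case: (g y) => c d /=; ring.
have E2 y : Im ((f y)^*%C * g y) = Re (f y) * Im (g y) - Im (f y) * Re (g y).
  by case: (f y) => a b; case: (g y) => c d /=; ring.
have cn : {for x, continuous (fun y => Re (f y) * Re (g y) + Im (f y) * Im (g y) -
    `|Re (f y) * Im (g y) - Im (f y) * Re (g y)|)}.
  apply: cvgB; first by apply: cvgD; apply: cvgM.
  by apply: cvg_norm; apply: cvgB; apply: cvgM.
have : 0 < Re (f x) * Re (g x) + Im (f x) * Im (g x) -
    `|Re (f x) * Im (g x) - Im (f x) * Re (g x)|.
  by rewrite subr_gt0 -E1 -E2.
move=> /(near_gt0 cn); apply: filterS => y.
by rewrite subr_gt0 -E1 -E2.
Qed.

Lemma good_refl (u : C) : u != 0 -> good u u.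
Proof.
move=> u0; have := normc2_neq0 u0; rewrite /good; case: u u0 => a b _ /= n0.
have -> : a * b + - b * a = 0 by ring.
rewrite normr0; have -> : a * a - - b * b = a ^+ 2 + b ^+ 2 by ring.
by rewrite lt0r n0 addr_ge0 ?sqr_ge0.
Qed.

End ComplexContinuity.

Lemma cts_at_comp (R : realType) (T S : topologicalType) (f : S -> R[i]) (g : T -> S) x :
  cts_at f (g x) -> {for x, continuous g} -> cts_at (fun y => f (g y)) x.
Proof.
by move=> [f1 f2] cg; split; [exact: (continuous_comp cg f1)|exact: (continuous_comp cg f2)].
Qed.

Lemma continuous_expi (R : realType) t : cts_at (@expi R) t.
Proof. by split; [exact: continuous_cos|exact: continuous_sin]. Qed.

(** * Complex coordinates on a configuration space *)

Section Chart.
Variables (R : realType).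
Local Notation C := R[i].

Definition valid (q : seq C) n (u : 'I_n -> C) :=
  injective u /\ forall i, u i \notin q.

(** A homeomorphism of [X] with the configurations of [n] points of the plane outside [q]. The
    inverse [mk] is total but meaningful on [valid] families only; its continuity is stated for
    families depending on a parameter, coordinate by coordinate. *)
Record chart (X : topologicalType) (q : seq C) (n : nat) := Chart {
  pc : X -> 'I_n -> C;
  mk : ('I_n -> C) -> X;
  pc_valid : forall x, valid q (pc x);
  pcK : forall x, mk (pc x) = x;
  mkK : forall u, valid q u -> pc (mk u) = u;
  pc_cts : forall i x, cts_at (fun x => pc x i) x;
  mk_cts : forall (T : topologicalType) (u : T -> 'I_n -> C) (z : T),
    valid q (u z) -> (forall i, cts_at (u^~ i) z) ->
    {for z, continuous (fun y => mk (u y))} }.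

End Chart.

Lemma connect_invariant (T : finType) (e : rel T) (S : Type) (f : T -> S) p q :
  (forall x y, e x y -> f x = f y) -> connect e p q -> f p = f q.
Proof.
move=> fe /connectP[s + ->]; elim: s p => //= y s IH p /andP[py ys].
by rewrite (fe _ _ py); exact: IH.
Qed.

Lemma connect_intermediate (T : finType) (e : rel T) (f : T -> nat) p q j :
  (forall x y, e x y -> (f y <= (f x).+1)%N) -> connect e p q ->
  (f p <= j <= f q)%N -> exists2 x, connect e p x & f x = j.
Proof.
move=> fe /connectP[s + ->]; elim: s p => [|y s IH] p /=.
  by move=> _ pj; exists p; [exact: connect0|apply/eqP; rewrite eqn_leq].
move=> /andP[py ys] /andP[pj jq].
have [pE|pN] := eqVneq (f p) j; first by exists p.
have [|x yx xj] := IH y ys.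
  rewrite jq andbT; apply: leq_trans (fe _ _ py) _.
  by rewrite ltn_neqAle pN.
by exists x => //; apply: connect_trans yx; exact: connect1.
Qed.

Section DiscreteWinding.
Variable R : realType.

Definition angle_sum (W : nat -> R[i]) (n : nat) := \sum_(l < n) ang (W l) (W l.+1).

(** Discrete homotopy invariance: [ang_quad] is applied to each square between the two polygonal
    paths, and the inner sides telescope. *)
Lemma angle_sum_near (V W : nat -> R[i]) n :
  (forall l, (l <= n)%N -> good (V l) (W l)) ->
  (forall l, (l < n)%N -> good (V l) (V l.+1)) ->
  (forall l, (l < n)%N -> good (W l) (W l.+1)) ->
  angle_sum W n = angle_sum V n + ang (V n) (W n) - ang (V 0%N) (W 0%N).
Proof.
rewrite /angle_sum; elim: n => [|n IH] gVW gV gW; first by rewrite !big_ord0 add0r subrr.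
rewrite !big_ord_recr /= IH; last 3 first.
- by move=> l ln; apply: gVW; exact: leqW.
- by move=> l ln; apply: gV; exact: leqW.
- by move=> l ln; apply: gW; exact: leqW.
have := ang_quad (gVW n (leqnSn n)) (gW n (ltnSn n)) (gV n (ltnSn n)) (gVW n.+1 (leqnn _)).
lra.
Qed.

End DiscreteWinding.

(** * Two independent tori force many open sets *)

Section LowerBound.
Variables (R : realType) (X : topologicalType) (n : nat) (A : finType).
Local Notation N := n.+1.
Local Notation C := R[i].
Variable w : A -> X -> C.
Hypothesis w_cts : forall a x, cts_at (w a) x.
Hypothesis w_neq0 : forall a x, w a x != 0.
Variables Phi Psi : 'rV[R]_N -> X.
Hypotheses (Phi_cts : continuous Phi) (Psi_cts : continuous Psi).
Hypothesis Phi_periodic : forall x y : 'rV[R]_N,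
  (forall i, expi (x 0 i) = expi (y 0 i)) -> Phi x = Phi y.
Hypothesis Psi_periodic : forall x y : 'rV[R]_N,
  (forall i, expi (x 0 i) = expi (y 0 i)) -> Psi x = Psi y.
(** Up to a constant and an error below [pi / 4], the argument of [w a] along [Phi] is the torus
    coordinate [alpha a], or 0 for [None]; [beta] is the analogue for [Psi]. *)
Variables alpha beta : A -> option 'I_N.
Let angle (f : 'I_N -> R) (o : option 'I_N) := oapp f 0 o.
Variables zPhi zPsi : A -> C.
Hypothesis Phi_angle : forall a (x : 'rV[R]_N),
  good (zPhi a * expi (angle (x 0) (alpha a))) (w a (Phi x)).
Hypothesis Psi_angle : forall a (x : 'rV[R]_N),
  good (zPsi a * expi (angle (x 0) (beta a))) (w a (Psi x)).
(** A loop of class [v] along which every [w a] turns equally on both tori is trivial. *)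
Hypothesis independent : forall v : 'I_N -> R,
  (forall a, angle v (alpha a) = angle v (beta a)) -> forall i, v i = 0.

Let torus x := (Phi x, Psi x).

Let torus_cts : continuous torus.
Proof. by move=> x; apply: continuous_pair; [exact: Phi_cts|exact: Psi_cts]. Qed.

(** Near [x], at scale [e] in both the torus parameter and time, the planned motion changes the
    argument of each [w a] by less than [pi / 4]. *)
Definition tame (U : set (X * X)) (h : (X * X) * R -> X) (x : 'rV[R]_N) (e : R) :=
  forall y z, ball x e y -> ball x e z -> U (torus y) /\
    forall s t, 0 <= s <= 1 -> 0 <= t <= 1 -> `|s - t| < e ->
      forall a, good (w a (h (torus y, s))) (w a (h (torus z, t))).

(** A nonzero value is [good] with itself, hence with nearby values; compactness of the time
    interval makes the radius uniform in time. *)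
Lemma tame_local U h x : open U -> planner U h -> U (torus x) ->
  exists2 e, 0 < e & tame U h x e.
Proof.
move=> oU [hc h0 h1] Ux.
have [e0 e00 e0U] : exists2 e, 0 < e & ball x e `<=` torus @^-1` U.
  have : nbhs x (torus @^-1` U) by apply: torus_cts; exact: open_nbhs_nbhs.
  by move=> /nbhs_ballP[e e0 ?]; exists e.
pose G a (z : 'rV[R]_N * R) := w a (h (torus z.1, z.2)).
have Gc a t : 0 <= t <= 1 -> cts_at (G a) (x, t).
  move=> t01; apply: (cts_at_comp (f := w a) (g := fun z : 'rV[R]_N * R => h (torus z.1, z.2))).
    exact: w_cts.
  apply: (@continuous_comp _ _ _ (fun z : 'rV[R]_N * R => (torus z.1, z.2)) h); last exact: hc.
  apply: continuous_pair; last exact: cvg_snd.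
  apply: (@continuous_comp _ _ _ fst torus); [exact: cvg_fst|exact: torus_cts].
pose P (e : R) (s : R) := forall y z, ball x e y -> ball x e z ->
  forall t, 0 <= t <= 1 -> `|s - t| < e -> forall a, good (G a (y, s)) (G a (z, t)).
have : \forall e \near 0^'+, `[0, 1] `<=` P e.
  have /compact_near_coveringP := @segment_compact R 0 1; apply => s.
  rewrite /= in_itv /= => s01.
  have : \forall z \near ((x, s), (x, s)), forall a, good (G a z.1) (G a z.2).
    have gnear a : \forall z \near ((x, s), (x, s)), good (G a z.1) (G a z.2).
      apply: (@good_near_at R _ (fun z => G a z.1) (fun z => G a z.2)).
      - by apply: (cts_at_comp (f := G a) (g := fst)); [exact: Gc|exact: cvg_fst].
      - by apply: (cts_at_comp (f := G a) (g := snd)); [exact: Gc|exact: cvg_snd].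
      - by apply: good_refl; exact: w_neq0.
    exact: (@filter_forall _ A _ (nbhs ((x, s), (x, s))) _ gnear).
  move=> /nbhs_ballP[d /= d0 dP].
  exists (ball s (d / 2), [set e | e < d / 2]).
    split; first by apply: nbhsx_ballx; rewrite divr_gt0.
    by apply: nbhs_right_lt; rewrite divr_gt0.
  move=> [s' e] /= [ss' ed] y z xy xz t t01 st a.
  have lty u : ball x e u -> ball x d u.
    by apply: le_ball; apply: ltW; apply: lt_trans ed _; rewrite ltr_pdivrMr // ltr_pMr ?ltr1n.
  apply: (dP ((y, s'), (z, t))); split; split => //=; [exact: lty| |exact: lty|].
    by apply: le_ball ss'; rewrite ler_pdivrMr // ler_pMr ?ler1n.
  move: ss'; rewrite /ball /= => ss'; rewrite -(subrKA s').
  apply: le_lt_trans (ler_normD _ _) _; rewrite [ltRHS]splitr.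
  by apply: ltrD => //; exact: lt_trans ed.
move=> /(filterI (nbhs_right_gt 0)) /filter_ex[e [/= epos eP]].
exists (Num.min e e0).
  by rewrite lt_min epos e00.
have le1 u : ball x (Num.min e e0) u -> ball x e u by apply: le_ball; rewrite ge_min lexx.
have le2 u : ball x (Num.min e e0) u -> ball x e0 u by apply: le_ball; rewrite ge_min lexx orbT.
move=> y z xy xz; split; first by apply: e0U; exact: le2.
move=> s t s01 t01; rewrite lt_min => /andP[st _] a.
have s01' : `[0, 1]%classic s by rewrite /= in_itv.
exact: (eP s s01' y z (le1 _ xy) (le1 _ xz) t t01 st a).
Qed.

Variables (k : nat) (U : 'I_k -> set (X * X)) (h : 'I_k -> (X * X) * R -> X).
Hypothesis U_open : forall i, open (U i).
Hypothesis U_cover : forall p, exists i, U i p.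
Hypothesis h_planner : forall i, planner (U i) (h i).

(** A Lebesgue number, by compactness of the fundamental cube of the torus. *)
Lemma tame_uniform : exists2 e : R, 0 < e &
  forall x : 'rV[R]_N, (forall i, 0 <= x 0 i <= pi *+ 2) -> exists i, tame (U i) (h i) x e.
Proof.
pose K := [set x : 'rV[R]_N | forall i, `[0, pi *+ 2]%classic (x 0 i)].
have : \forall e \near 0^'+, K `<=` fun x => exists i, tame (U i) (h i) x e.
  have /compact_near_coveringP : compact K.
    exact: (@rV_compact R N (fun=> `[0, pi *+ 2]%classic) (fun=> @segment_compact R _ _)).
  apply => x _; have [i Ui] := U_cover (torus x).
  have [d d0 dP] := tame_local (@U_open i) (@h_planner i) Ui.
  exists (ball x (d / 2), [set e | e < d / 2]).
    split; first by apply/nbhs_ballP; exists (d / 2) => //=; rewrite divr_gt0.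
    by apply: nbhs_right_lt; rewrite divr_gt0.
  move=> [x' e] /= [xx' ed]; exists i => y z x'y x'z.
  have lty u : ball x' e u -> ball x d u.
    move=> x'u; rewrite [d]splitr; apply: ball_triangle xx' _.
    by apply: le_ball x'u; exact: ltW.
  have [? H] := dP _ _ (lty _ x'y) (lty _ x'z); split => // s t s01 t01 st.
  by apply: H => //; apply: lt_trans st _; apply: lt_trans ed _; rewrite ltr_pdivrMr // ltr_pMr ?ltr1n.
move=> /(filterI (nbhs_right_gt 0)) /filter_ex[e [e0 eP]]; exists e => //.
Qed.

(** Otherwise the open sets colour a grid of the universal cover with at most [N] colours. The Hex
    theorem gives a long monochromatic chain, which contains two points with the same image in the
    torus; the invariance of [inv] along the chain then contradicts [independent]. *)
Theorem too_few_planners : (N < k)%N.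
Proof.
case: (leqP k N) => // kN; exfalso.
have pi0 := pi_gt0 R.
have pi2 : 0 < pi *+ 2 :> R by rewrite mulrn_wgt0.
have [e e0 eP] := tame_uniform.
(* The mesh [2 pi / M] is below [e], and at most [pi] since [M] is at least 2, as [ang_lift]
   requires. The time step [1 / T] is also below [e]. *)
pose M := (Num.bound (pi *+ 2 / e)).+2.
pose T := (Num.bound e^-1).+1.
have M0 : 0 < M%:R :> R by rewrite ltr0n.
have Me : pi *+ 2 / M%:R < e.
  have b0 : 0 <= pi *+ 2 / e by rewrite ltW // divr_gt0.
  rewrite ltr_pdivrMr // mulrC -ltr_pdivrMr //.
  apply: lt_trans (archi_boundP b0) _; by rewrite ltr_nat /M leqnSn.
have M2 : pi *+ 2 / M%:R <= pi :> R.
  by rewrite ler_pdivrMr // -[pi *+ 2]mulr_natr ler_pM2l // ler_nat /M.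
have T0 : 0 < T%:R :> R by rewrite ltr0n.
have Te : T%:R^-1 < e.
  have b0 : 0 <= e^-1 by rewrite invr_ge0 ltW.
  rewrite -[e]invrK ltf_pV2 ?posrE ?invr_gt0 //.
  apply: lt_trans (archi_boundP b0) _; by rewrite ltr_nat /T.
pose th (p : 'I_N -> nat) : 'rV[R]_N := \row_i (pi *+ 2 * (p i)%:R / M%:R).
have thE p i : th p 0 i = pi *+ 2 * (p i)%:R / M%:R by rewrite mxE.
(* Reduction modulo [M] brings a grid point into the compact cube without changing its image in the
   torus. *)
pose res (p : 'I_N -> nat) : {ffun 'I_N -> 'I_M} := [ffun i => inord (p i %% M)].
have resE p i : res p i = (p i %% M)%N :> nat.
  by rewrite ffunE inordK // ltn_mod.
pose rth (r : {ffun 'I_N -> 'I_M}) := th (fun i => r i).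
have th_res p i : expi (rth (res p) 0 i) = expi (th p 0 i).
  rewrite /rth !thE resE [in RHS](divn_eq (p i) M) natrD natrM addrC mulrDr mulrDl.
  rewrite [X in _ + X](_ : _ = pi *+ 2 * (p i %/ M)%:R) ?expiD2pi //.
  by rewrite mulrA mulfK // gt_eqF.
have /choice[cval cvalP] : forall r : {ffun 'I_N -> 'I_M}, exists i, tame (U i) (h i) (rth r) e.
  move=> r; apply: eP => i; rewrite /rth thE.
  rewrite divr_ge0 ?mulr_ge0 ?(ltW pi2) ?ler0n //= ler_pdivrMr //.
  by rewrite ler_pM2l // ler_nat ltnW.
pose col p := cval (res p).
pose close (p q : 'I_N -> nat) := forall i, (p i <= (q i).+1)%N && (q i <= (p i).+1)%N.
have closeB p q i : close p q -> `|th q 0 i - th p 0 i| <= pi *+ 2 / M%:R.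
  move=> /(_ i) pq; rewrite !thE -mulrBl -mulrBr normrM normfV normrM.
  rewrite (gtr0_norm M0) (gtr0_norm pi2).
  rewrite ler_pM2r ?invr_gt0 // -[leRHS]mulr1 ler_pM2l //.
  case/andP: pq; rewrite -!(ler_nat R) -!natr1 ler_norml; lra.
have step p q : close p q -> U (col p) (torus (th q)) /\
    forall s t, 0 <= s <= 1 -> 0 <= t <= 1 -> `|s - t| < e -> forall a,
      good (w a (h (col p) (torus (th p), s))) (w a (h (col p) (torus (th q), t))).
  (* [z] has the same image in the torus as [th q], and lies close to the representative of [p] in
     the cube, where tameness is known. *)
  move=> pq; pose z := rth (res p) + (th q - th p).
  have zE : torus z = torus (th q).
    have zq i : expi (z 0 i) = expi (th q 0 i).
      by rewrite mxE [X in _ + X]mxE [X in _ + (_ + X)]mxE expiD th_res -expiD addrCA subrr addr0.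
    by rewrite /torus (Phi_periodic zq) (Psi_periodic zq).
  have pE : torus (rth (res p)) = torus (th p).
    by rewrite /torus (Phi_periodic (th_res p)) (Psi_periodic (th_res p)).
  have xz : ball (rth (res p)) e z.
    split=> // a i; rewrite (ord1 a) /ball /=.
    have -> : z 0 i = rth (res p) 0 i + (th q 0 i - th p 0 i).
      by rewrite mxE [X in _ + X]mxE [X in _ + (_ + X)]mxE.
    rewrite opprD addNKr normrN; exact: le_lt_trans (closeB _ _ _ pq) Me.
  have [Uz _] := cvalP (res p) z z xz xz.
  rewrite -zE -pE; split => // s t s01 t01 st a.
  by have [_ H] := cvalP (res p) _ _ (ballxx _ e0) xz; exact: H.
pose W (c : 'I_k) a p (l : nat) := w a (h c (torus (th p), l%:R / T%:R)).
have close_refl p : close p p by move=> i; rewrite leqnSn.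
have t01 l : (l <= T)%N -> 0 <= (l%:R / T%:R : R) <= 1.
  by move=> lT; rewrite divr_ge0 ?ler0n //= ler_pdivrMr // mul1r ler_nat.
have goodW a p q l : close p q -> (l <= T)%N -> good (W (col p) a p l) (W (col p) a q l).
  move=> pq lT; have [_ H] := step p q pq.
  by apply: H; rewrite ?t01 // subrr normr0.
have goodS a p q l : close p q -> (l < T)%N -> good (W (col p) a q l) (W (col p) a q l.+1) \/ col q <> col p.
  move=> pq lT; have [->|] := eqVneq (col p) (col q); last by move/eqP => ne; right => qp; apply: ne.
  left; have [_ H] := step q q (close_refl q).
  apply: H; rewrite ?t01 // 1?ltnW // -mulrBl -natr1 opprD addrA subrr add0r.
  by rewrite mulN1r normrN gtr0_norm // invr_gt0.
have W0 a p q : close p q -> W (col p) a q 0 = w a (Phi (th q)).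
  move=> pq; have [Uq _] := step p q pq; rewrite /W mul0r.
  by have [_ -> //] := @h_planner (col p).
have WT a p q : close p q -> W (col p) a q T = w a (Psi (th q)).
  move=> pq; have [Uq _] := step p q pq; rewrite /W divff ?gt_eqF //.
  by have [_ _ -> //] := @h_planner (col p).
have angleB p q o : close p q -> `|angle (th q 0) o - angle (th p 0) o| <= pi.
  move=> pq; case: o => [i|] /=; last by rewrite subrr normr0 ltW.
  exact: le_trans (closeB _ _ _ pq) M2.
(* [lam] and [mu] are real lifts of the argument of [w a] on the two tori, relative to [zPhi a] and
   [zPsi a]. *)
pose lam a p := angle (th p 0) (alpha a) +
  ang (zPhi a * expi (angle (th p 0) (alpha a))) (w a (Phi (th p))).
pose mu a p := angle (th p 0) (beta a) +
  ang (zPsi a * expi (angle (th p 0) (beta a))) (w a (Psi (th p))).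
(* The difference between the angles of [w a] at the end of the planned paths computed
   along the torus [Psi] and along [Phi] followed by the path: it is constant on
   monochromatic components. *)
pose inv a p := mu a p - lam a p - angle_sum (W (col p) a p) T.
have inv_step a p q : close p q -> col p = col q -> inv a p = inv a q.
  move=> pq cpq.
  have g0 : good (w a (Phi (th p))) (w a (Phi (th q))).
    by rewrite -(W0 a p p) // -(W0 a p q) //; exact: goodW.
  have gT : good (w a (Psi (th p))) (w a (Psi (th q))).
    by rewrite -(WT a p p) // -(WT a p q) //; exact: goodW.
  have lamE : lam a q = lam a p + ang (w a (Phi (th p))) (w a (Phi (th q))).
    exact: ang_lift (Phi_angle a _) (Phi_angle a _) g0 (angleB _ _ _ pq).
  have muE : mu a q = mu a p + ang (w a (Psi (th p))) (w a (Psi (th q))).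
    exact: ang_lift (Psi_angle a _) (Psi_angle a _) gT (angleB _ _ _ pq).
  have := @angle_sum_near R (W (col p) a p) (W (col p) a q) T.
  rewrite (W0 a p p) // (W0 a p q) // (WT a p p) // (WT a p q) // /inv lamE muE -cpq => ->.
  - by ring.
  - by move=> l; exact: goodW.
  - by move=> l lT; have [|/(_ erefl)] := goodS a p p l (close_refl p) lT.
  - by move=> l lT; have [|] := goodS a p q l pq lT; rewrite ?cpq.
(* A chain crossing the width [L] meets the [cells + 1] hyperplanes where coordinate [i] is a
   multiple of [M]: one more than there are residue classes. *)
pose cells := #|{ffun 'I_N -> 'I_M}|; pose L := (cells * M)%N.
pose nat_of (p : {ffun 'I_N -> 'I_L.+1}) : 'I_N -> nat := fun i => p i.
pose c p := widen_ord kN (col (nat_of p)).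
have [i [p [q [pq p0 qL]]]] := hex c.
have adjP x y : mono_adj c x y -> close (nat_of x) (nat_of y) /\ col (nat_of x) = col (nat_of y).
  move=> /andP[/eqP cxy /forallP xy]; split; first exact: xy.
  by apply: val_inj; have /(congr1 val) := cxy.
have inv_conn a x y : connect (mono_adj c) x y -> inv a (nat_of x) = inv a (nat_of y).
  apply: (connect_invariant (f := fun x => inv a (nat_of x))) => {}x {}y /adjP[? ?].
  exact: inv_step.
have col_conn x y : connect (mono_adj c) x y -> col (nat_of x) = col (nat_of y).
  by apply: (connect_invariant (f := fun x => col (nat_of x))) => {}x {}y /adjP[].
have /choice[g gP] : forall j : 'I_cells.+1, exists x,
    connect (mono_adj c) p x /\ nat_of x i = (j * M)%N.
  move=> j; have [||x px xj] := @connect_intermediate _ (mono_adj c) (fun x => nat_of x i) p q (j * M) _ pq.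
  - by move=> x y /adjP[/(_ i)/andP[]].
  - by rewrite /nat_of p0 qL /= leq_mul2r -ltnS ltn_ord orbT.
  - by exists x.
have /injectivePn[j [j' jj' resjj']] : ~~ injectiveb (fun j => res (nat_of (g j))).
  apply/negP => /injectiveP /leq_card; rewrite card_ord.
  by rewrite ltnn.
have [pj gj] := gP j; have [pj' gj'] := gP j'.
set x := g j in pj gj resjj'; set y := g j' in pj' gj' resjj'.
have sym := sym_connect_sym (mono_adj_sym c).
have xy : connect (mono_adj c) x y by apply: connect_trans pj'; rewrite sym.
have expixy l : expi (th (nat_of x) 0 l) = expi (th (nat_of y) 0 l).
  by rewrite -th_res resjj' th_res.
have Phixy := Phi_periodic expixy; have Psixy := Psi_periodic expixy.
have expi_angle o : expi (angle (th (nat_of x) 0) o) = expi (angle (th (nat_of y) 0) o).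
  by case: o => [l|//] /=.
(* The class of the loop; its coordinate [i] is [2 pi (j' - j)], which is nonzero. *)
pose v l := th (nat_of y) 0 l - th (nat_of x) 0 l.
have angle_diff o : angle v o =
    angle (th (nat_of y) 0) o - angle (th (nat_of x) 0) o.
  by case: o => [l|] //=; rewrite subrr.
suff vE : forall a, angle v (alpha a) = angle v (beta a).
  have /eqP := independent vE i; rewrite /v !thE gj gj' -mulrBl -mulrBr mulf_eq0 invr_eq0 (gt_eqF M0) orbF.
  rewrite mulf_eq0 (gt_eqF pi2) /= subr_eq0 eqr_nat eqn_mul2r /=.
  by rewrite eq_sym -(inj_eq val_inj) in jj'; rewrite (negbTE jj').
move=> a; rewrite !angle_diff.
have := inv_conn a x y xy; rewrite /inv /lam /mu /W -(col_conn _ _ xy).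
rewrite /torus -Phixy -Psixy -!expi_angle; lra.
Qed.

End LowerBound.

(** * Lower bounds from pairs of tori *)

Section Tori.
Variable R : realType.
Local Notation C := R[i].
Local Notation normc := (@Normc.normc R).

Lemma normc_ge0 (z : C) : 0 <= normc z.
Proof. by case: z => a b /=; exact: sqrtr_ge0. Qed.

Lemma normc_gt0 (z : C) : z != 0 -> 0 < normc z.
Proof.
by rewrite lt0r normc_ge0 andbT; apply: contra => /eqP/Normc.eq0_normc ->.
Qed.

Lemma normc_polar (r t : R) : 0 <= r -> normc (r%:C%C * expi t) = r.
Proof.
move=> r0; rewrite Normc.normcM normc_expi mulr1 /= expr0n addr0 sqrtr_sqr.
exact: ger0_norm.
Qed.

Lemma good_polarD (r s : R) (t t' : R) : 0 <= s -> s * 2 < r ->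
  good (expi t) (r%:C%C * expi t + s%:C%C * expi t').
Proof.
move=> s0 sr; have r0 : 0 < r by apply: le_lt_trans sr; rewrite mulr_ge0.
apply: (good_scale r0); apply: good_near.
by rewrite addrC addKr !normc_polar // ltW.
Qed.

Lemma expiDpi (t : R) : expi (t + pi) = - expi t.
Proof. by rewrite /expi cosDpi sinDpi; apply/eqP; rewrite eq_complex /= !eqxx. Qed.

Variables (n k : nat).
Implicit Types (a : 'I_n -> option 'I_k) (x : 'rV[R]_k).

(** Point [j] runs on the circle of radius [r j] around [c], driven by the torus coordinate [a j];
    [None] keeps it at angle 0. *)
Definition orbit_conf (c : C) (r : 'I_n -> R) a x (j : 'I_n) : C :=
  c + (r j)%:C%C * expi (oapp (x 0) 0 (a j)).

Variables (c : C) (r : 'I_n -> R) (a : 'I_n -> option 'I_k).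
Hypothesis r_gt0 : forall j, 0 < r j.

(** The outer point dominates the difference, which therefore nearly has its direction. *)
Lemma orbit_conf_pair x i j : r i * 2 < r j ->
  good (1 * expi (oapp (x 0) 0 (a j))) (orbit_conf c r a x j - orbit_conf c r a x i).
Proof.
move=> ij; rewrite mul1r /orbit_conf opprD addrACA subrr add0r -mulrN -expiDpi.
by apply: good_polarD => //; exact: ltW.
Qed.

Lemma good_opp (u v : C) : good u v -> good (- u) (- v).
Proof. by rewrite /good rmorphN mulrNN. Qed.

Lemma orbit_conf_pairN x i j : r j * 2 < r i ->
  good (-1 * expi (oapp (x 0) 0 (a i))) (orbit_conf c r a x j - orbit_conf c r a x i).
Proof.
move=> ij; rewrite mulN1r -opprB; apply: good_opp.
by have := orbit_conf_pair x ij; rewrite mul1r.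
Qed.

Lemma orbit_conf_center x j :
  good (1 * expi (oapp (x 0) 0 (a j))) (orbit_conf c r a x j - c).
Proof.
rewrite mul1r /orbit_conf addrAC subrr add0r -[X in good _ X]addr0 -[X in _ + X](mul0r (expi 0)).
by apply: good_polarD => //; rewrite mul0r.
Qed.

Lemma orbit_conf_far x j p : r j * 2 < normc (c - p) ->
  good ((c - p) * expi 0) (orbit_conf c r a x j - p).
Proof.
move=> jp; rewrite expi0 mulr1; apply: good_near.
have -> : orbit_conf c r a x j - p - (c - p) = (r j)%:C%C * expi (oapp (x 0) 0 (a j)).
  by rewrite /orbit_conf; ring.
by rewrite normc_polar // ltW.
Qed.

Variable q : seq C.
Hypothesis r_apart : forall i j, i != j -> (r i * 2 < r j) || (r j * 2 < r i).
Hypothesis r_far : forall p j, p \in q -> p != c -> r j * 2 < normc (c - p).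

Lemma orbit_conf_valid x : valid q (orbit_conf c r a x).
Proof.
split=> [i j eij|j].
  apply: contra_eq eij => ij; rewrite -subr_eq0.
  have /orP[H|H] := r_apart ij.
    by rewrite -oppr_eq0 opprB; apply: (good_neq0 (good_sym (orbit_conf_pair x H))).
  exact: (good_neq0 (good_sym (orbit_conf_pair x H))).
apply/negP => jq; move: (jq).
have [jc _|jc /r_far/(_ jc) H] := eqVneq (orbit_conf c r a x j) c.
  by have := good_neq0 (good_sym (orbit_conf_center x j)); rewrite jc subrr eqxx.
have := good_neq0 (good_sym (orbit_conf_far x (H j))); by rewrite subrr eqxx.
Qed.

Lemma orbit_conf_cts j x : cts_at (fun x => orbit_conf c r a x j) x.
Proof.
apply: cts_atD; first exact: cts_at_cst.
apply: cts_atM; first exact: cts_at_cst.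
case: (a j) => [i|] /=; last exact: cts_at_cst.
apply: (cts_at_comp (f := @expi R)); first exact: continuous_expi.
exact: coord_continuous.
Qed.

End Tori.

Section TwoTori.
Variables (R : realType) (X : topologicalType) (q : seq R[i]) (n k : nat).
Local Notation C := R[i].
Local Notation normc := (@Normc.normc R).
Local Notation N := k.+1.
Variables (ch : chart X q n) (c0 c1 : C) (a b : 'I_n -> option 'I_N).
(** The argument of [x_j - x_i] follows the outer of the two points: [j] on the first torus, and [i]
    on the second, where radii decrease. A point turns around a puncture only if that puncture is
    the centre. *)
Hypothesis independent : forall v : 'I_N -> R,
  (forall i j : 'I_n, (i < j)%N -> oapp v 0 (a j) = oapp v 0 (b i)) ->
  (forall j p, p \in q -> oapp v 0 (if p == c0 then a j else None) =
                          oapp v 0 (if p == c1 then b j else None)) ->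
  forall i, v i = 0.

Lemma dist_lower_bound (c : C) (s : seq C) :
  exists2 d : R, 0 < d & forall p, p \in s -> p != c -> d <= normc (c - p).
Proof.
elim: s => [|p s [d d0 IH]]; first by exists 1.
have [->|pc] := eqVneq p c.
  by exists d => // x; rewrite inE => /predU1P[->|/IH]; rewrite ?eqxx.
exists (Num.min d (normc (c - p))).
  by rewrite lt_min d0 normc_gt0 // subr_eq0 eq_sym.
move=> x; rewrite inE => /predU1P[-> _|xs xc]; first by rewrite ge_min lexx orbT.
by rewrite ge_min IH.
Qed.

Lemma two_tori_lower m : has_motion_planners R X m -> (N < m)%N.
Proof.
move=> [U [Ucov Upl]].
have [d0 d00 d0P] := dist_lower_bound c0 q.
have [d1 d10 d1P] := dist_lower_bound c1 q.
(* Radii are [e] times powers of 3, so each exceeds twice any smaller one; [e] keeps twice the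
   largest below the distance from a centre to the other punctures. *)
pose e := Num.min d0 d1 / (3 ^+ n.+1).
have e3 (j : nat) : 0 < 3 ^+ j :> R by rewrite exprn_gt0.
have e0 : 0 < e by rewrite divr_gt0 // lt_min d00.
have e_apart i j : (i < j)%N -> e * 3 ^+ i * 2 < e * 3 ^+ j.
  move=> ij; rewrite -mulrA ltr_pM2l //.
  apply: (@lt_le_trans _ _ (3 ^+ i.+1)); last by rewrite ler_eXn2l // ltr1n.
  by rewrite exprSr ltr_pM2l // ltr_nat.
have ed j : (j <= n)%N -> e * 3 ^+ j * 2 < Num.min d0 d1.
  by move=> jn; have := @e_apart j n.+1 jn; rewrite {2}/e divfK // gt_eqF.
pose r0 (j : 'I_n) := e * 3 ^+ j; pose r1 (j : 'I_n) := e * 3 ^+ (n - j)%N.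
have r0_gt0 j : 0 < r0 j by rewrite mulr_gt0.
have r1_gt0 j : 0 < r1 j by rewrite mulr_gt0.
have r0_lt (i j : 'I_n) : (i < j)%N -> r0 i * 2 < r0 j by exact: e_apart.
have r1_lt (i j : 'I_n) : (i < j)%N -> r1 j * 2 < r1 i.
  by move=> ij; apply: e_apart; have := ltn_ord j; lia.
have r0_apart i j : i != j -> (r0 i * 2 < r0 j) || (r0 j * 2 < r0 i).
  by rewrite neq_ltn => /orP[/r0_lt ->|/r0_lt ->]; rewrite ?orbT.
have r1_apart i j : i != j -> (r1 i * 2 < r1 j) || (r1 j * 2 < r1 i).
  by rewrite neq_ltn => /orP[/r1_lt ->|/r1_lt ->]; rewrite ?orbT.
have r0_far p j : p \in q -> p != c0 -> r0 j * 2 < normc (c0 - p).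
  move=> pq pc; apply: lt_le_trans (d0P _ pq pc).
  by apply: lt_le_trans (ed j (ltnW (ltn_ord j))) _; rewrite ge_min lexx.
have r1_far p j : p \in q -> p != c1 -> r1 j * 2 < normc (c1 - p).
  move=> pq pc; apply: lt_le_trans (d1P _ pq pc).
  by apply: lt_le_trans (ed _ (leq_subr _ _)) _; rewrite ge_min lexx orbT.
pose u0 := orbit_conf c0 r0 a; pose u1 := orbit_conf c1 r1 b.
have v0 x : valid q (u0 x) by exact: orbit_conf_valid.
have v1 x : valid q (u1 x) by exact: orbit_conf_valid.
pose pt (l : 'I_(size q)) := tnth (in_tuple q) l.
have ptq l : pt l \in q by exact: mem_tnth.
(* The functions [w] are the differences between two points and between a point and a puncture;
   pairs out of order receive the constant 1. *)
pose A := ('I_n * 'I_n + 'I_n * 'I_(size q))%type.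
pose w (s : A) (x : X) : C := match s with
  | inl (i, j) => if (i < j)%N then pc ch x j - pc ch x i else 1
  | inr (j, l) => pc ch x j - pt l end.
pose alpha (s : A) := match s with
  | inl (i, j) => if (i < j)%N then a j else None
  | inr (j, l) => if pt l == c0 then a j else None end.
pose beta (s : A) := match s with
  | inl (i, j) => if (i < j)%N then b i else None
  | inr (j, l) => if pt l == c1 then b j else None end.
pose z0 (s : A) := match s with
  | inl _ => 1
  | inr (j, l) => if pt l == c0 then 1 else c0 - pt l end.
pose z1 (s : A) := match s with
  | inl (i, j) => if (i < j)%N then -1 else 1
  | inr (j, l) => if pt l == c1 then 1 else c1 - pt l end.
have /choice[h hP] : forall i, exists h : (X * X) * R -> X, planner (U i) h.
  move=> i; have [Uo [s [sc se]]] := Upl i; exact: section_planner sc se.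
apply: (@too_few_planners R X k A w _ _ (fun x => mk ch (u0 x)) (fun x => mk ch (u1 x))
  _ _ _ _ alpha beta z0 z1 _ _ _ m U h) => //.
- move=> [[i j]|[j l]] x; rewrite /w /=.
    case: (i < j)%N; last exact: cts_at_cst.
    by apply: cts_atB; exact: pc_cts.
  by apply: cts_atB; [exact: pc_cts|exact: cts_at_cst].
- move=> [[i j]|[j l]] x; rewrite /w /=; have [inj nq] := pc_valid ch x.
    case: ifP => ij; last exact: oner_neq0.
    by rewrite subr_eq0 (inj_eq inj) eq_sym neq_ltn ij.
  by rewrite subr_eq0; apply: contraNneq (nq j) => ->.
- by move=> x; apply: (@mk_cts _ _ _ _ ch _ u0) => // i; exact: orbit_conf_cts.
- by move=> x; apply: (@mk_cts _ _ _ _ ch _ u1) => // i; exact: orbit_conf_cts.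
- move=> x y xy; congr (mk ch _); apply/funext => j.
  by rewrite /u0 /orbit_conf; case: (a j) => [i|] //=; rewrite xy.
- move=> x y xy; congr (mk ch _); apply/funext => j.
  by rewrite /u1 /orbit_conf; case: (b j) => [i|] //=; rewrite xy.
- move=> [[i j]|[j l]] x; rewrite /w /z0 /alpha /= mkK //.
    case: ifP => [ij|_]; first by apply: orbit_conf_pair => //; exact: r0_lt.
    by rewrite /= expi0 mulr1; apply: good_refl; exact: oner_neq0.
  case: eqVneq => [->|pc]; first exact: orbit_conf_center.
  by apply: orbit_conf_far => //; exact: r0_far.
- move=> [[i j]|[j l]] x; rewrite /w /z1 /beta /= mkK //.
    case: ifP => [ij|_]; first by apply: orbit_conf_pairN => //; exact: r1_lt.
    by rewrite /= expi0 mulr1; apply: good_refl; exact: oner_neq0.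
  case: eqVneq => [->|pc]; first exact: orbit_conf_center.
  by apply: orbit_conf_far => //; exact: r1_far.
- move=> v vE; apply: independent => [i j ij|j p pq].
    by have := vE (inl (i, j)); rewrite /= ij.
  have pl : (index p q < size q)%N by rewrite index_mem.
  have := vE (inr (j, Ordinal pl)); rewrite /= /pt (tnth_nth 0) /= nth_index //.
- by move=> i; have [] := Upl i.
- move=> p; have : [set: X * X] p by []; rewrite -Ucov => -[i _ ?]; by exists i.
Qed.

End TwoTori.

(** * Lower bounds for each number of punctures *)

Section Lower.
Variables (R : realType) (X : topologicalType) (q : seq R[i]) (n : nat).
Variable ch : chart X q n.
Hypothesis n_gt0 : (0 < n)%N.

(** The tori have distinct punctures as centres and [n] coordinates each. Winding around [p0] kills
    the coordinates of the first torus, winding around [p1] those of the second. *)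
Lemma lower_bound_many m : uniq q -> (1 < size q)%N ->
  has_motion_planners R X m -> (2 * n < m)%N.
Proof.
move=> uq sq; have -> : (2 * n = (2 * n).-1.+1)%N by lia.
set k := (2 * n).-1.
pose p0 := q`_0; pose p1 := q`_1.
have p01 : (p0 == p1) = false by rewrite nth_uniq //; exact: ltnW.
have p0q : p0 \in q by rewrite mem_nth // ltnW.
have p1q : p1 \in q by rewrite mem_nth.
apply: (@two_tori_lower _ _ _ _ k ch p0 p1 (fun j => Some (inord j)) (fun j => Some (inord (n + j)))).
move=> v _ vP i.
have [iN|Ni] := ltnP i n.
  by have := vP (Ordinal iN) p0 p0q; rewrite eqxx p01 /= inord_val.
have iN : (i - n < n)%N by move: Ni (ltn_ord i); rewrite /k /=; lia.
have := vP (Ordinal iN) p1 p1q; rewrite eqxx eq_sym p01 /= subnKC // inord_val.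
by move=> <-.
Qed.

(** Both tori turn around the puncture, and the outermost point of the second, point 0, is fixed:
    this leaves [n + (n - 1)] coordinates. The pairs [(0, j)], and the puncture for point 0, kill
    those of the first torus; winding around the puncture then kills those of the second. *)
Lemma lower_bound_one m : size q = 1%N ->
  has_motion_planners R X m -> (2 * n - 1 < m)%N.
Proof.
move=> sq; have -> : (2 * n - 1 = (2 * n - 2).+1)%N by lia.
set k := (2 * n - 2)%N; pose p0 := q`_0.
have p0q : p0 \in q by rewrite mem_nth // sq.
apply: (@two_tori_lower _ _ _ _ k ch p0 p0 (fun j => Some (inord j))
  (fun j => if val j == 0%N then None else Some (inord (n + j.-1)))).
move=> v vij vP.
have va (j : 'I_n) : v (inord j) = 0.
  have [j0|j0] := eqVneq (val j) 0%N.
    by have := vP j p0 p0q; rewrite eqxx /= j0 eqxx.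
  by have := vij (Ordinal n_gt0) j; rewrite /= lt0n => /(_ j0).
move=> i; have [iN|Ni] := ltnP i n; first by have := va (Ordinal iN); rewrite /= inord_val.
have iN : ((i - n).+1 < n)%N by move: Ni (ltn_ord i); rewrite /k /=; lia.
have := vP (Ordinal iN) p0 p0q; rewrite eqxx /= subnKC // inord_val => <-.
exact: (va (Ordinal iN)).
Qed.

(** The innermost point of each torus is fixed, as well as the outermost point 0 of the second: this
    leaves [(n - 1) + (n - 2)] coordinates. The pairs [(0, j)] kill those of the first torus, then
    the pairs [(j, n - 1)] those of the second. *)
Lemma lower_bound_none m : (1 < n)%N -> size q = 0%N ->
  has_motion_planners R X m -> (2 * n - 3 < m)%N.
Proof.
move=> n1 sq; have -> : (2 * n - 3 = (2 * n - 4).+1)%N by lia.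
set k := (2 * n - 4)%N.
apply: (@two_tori_lower _ _ _ _ k ch 0 0
  (fun j => if val j == 0%N then None else Some (inord j.-1))
  (fun j => if (val j == 0%N) || (val j == n.-1) then None else Some (inord (n.-1 + j.-1)))).
move=> v vij _.
have va (j : 'I_n) : val j != 0%N -> v (inord j.-1) = 0.
  by move=> j0; have := vij (Ordinal n_gt0) j; rewrite /= lt0n j0 (negbTE j0) /= => /(_ isT).
move=> i; have [iN|Ni] := ltnP i n.-1.
  have iN' : (i.+1 < n)%N by lia.
  by have := va (Ordinal iN'); rewrite /= inord_val => /(_ isT).
have jN : ((i - n.-1).+1 < n)%N by move: Ni (ltn_ord i); rewrite /k /=; lia.
have nN : (n.-1 < n)%N by lia.
have := vij (Ordinal jN) (Ordinal nN); rewrite /=.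
have -> : ((i - n.-1).+1 < n.-1)%N by move: Ni (ltn_ord i); rewrite /k /=; lia.
have -> : ((i - n.-1).+1 == n.-1) = false.
  by apply/negbTE; move: Ni (ltn_ord i); rewrite /k /=; lia.
have n10 : (n.-1 == 0%N) = false by apply/negbTE; lia.
rewrite n10 /= subnKC // inord_val => /(_ isT) <-.
by have := va (Ordinal nN); rewrite /= n10 => ->.
Qed.

End Lower.

(** * Upper bounds from stratifications *)

Section Homotopy.
Variables (R : realType) (T X : topologicalType).

Definition homot (N : set T) (a b : T -> X) := exists h : T * R -> X,
  [/\ forall p t, N p -> 0 <= t <= 1 -> {for (p, t), continuous h},
      forall p, N p -> h (p, 0) = a p &
      forall p, N p -> h (p, 1) = b p].

Lemma homot_trans N a b c : homot N a b -> homot N b c -> homot N a c.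
Proof.
move=> [f [fc f0 f1]] [g [gc g0 g1]].
pose f' (z : T * R) := f (z.1, z.2 *+ 2); pose g' (z : T * R) := g (z.1, z.2 *+ 2 - 1).
exists (fun z => if z.2 <= 2^-1 then f' z else g' z); split; last 2 first.
- by move=> p Np; rewrite /f' /= invr_ge0 ler0n mul0rn f0.
- move=> p Np; rewrite /g' /= leNgt invf_lt1 // ltr1n /=.
  by rewrite (_ : 1 *+ 2 - 1 = 1) ?g1 // mulr2n addrK.
have half : 2^-1 *+ 2 = 1 :> R by rewrite -[_ *+ 2]mulr_natr mulVf.
move=> p t Np /andP[t0 t1].
have c2 : {for (p, t), continuous (fun z : T * R => z.2 *+ 2)}.
  suff : {for (p, t), continuous (fun z : T * R => z.2 + z.2)} by [].
  by apply: cvgD; exact: cvg_snd.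
have fc' : t <= 2^-1 -> {for (p, t), continuous f'}.
  move=> tle; apply: (@continuous_comp _ _ _ (fun z : T * R => (z.1, z.2 *+ 2)) f).
    by apply: continuous_pair => //; exact: cvg_fst.
  by apply: fc => //=; rewrite mulrn_wge0 //= -half lerMn2r.
have gc' : 2^-1 <= t -> {for (p, t), continuous g'}.
  move=> tge; apply: (@continuous_comp _ _ _ (fun z : T * R => (z.1, z.2 *+ 2 - 1)) g).
    apply: continuous_pair; first exact: cvg_fst.
    by apply: cvgB => //; exact: cst_continuous.
  apply: gc => //=; rewrite subr_ge0 -half lerMn2r tge /=.
  by rewrite lerBlDr half -mulr2n lerMn2r.
case: (ltgtP t 2^-1) => [tlt|tgt|tE] O /=.
- rewrite ltW // => fO.
  have near_lt : \forall z \near (p, t), z.2 < 2^-1.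
    by apply: (@cvg_snd _ _ (nbhs p) (nbhs t) _ [set x | x < 2^-1]); exact: lt_nbhsl.
  by apply: filterS2 near_lt (fc' (ltW tlt) O fO) => z /= /ltW ->.
- rewrite leNgt tgt /= => gO.
  have near_gt : \forall z \near (p, t), 2^-1 < z.2.
    by apply: (@cvg_snd _ _ (nbhs p) (nbhs t) _ [set x | 2^-1 < x]); exact: lt_nbhsr.
  by apply: filterS2 near_gt (gc' (ltW tgt) O gO) => z /=; rewrite leNgt => ->.
(* At the junction both halves take the same value, so the two pulled back neighbourhoods can be
   intersected. *)
- rewrite -tE lexx => fO.
  have gO : nbhs (g' (p, t)) O.
    by move: fO; rewrite /f' /g' /= tE half subrr f1 // g0.
  have tge : 2^-1 <= t by rewrite tE.
  have tle : t <= 2^-1 by rewrite tE.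
  apply: (@filterS2 _ (nbhs (p, t)) _ _ _ _ _ (fc' tle O fO) (gc' tge O gO)) => z /= fz gz.
  by case: ifP.
Qed.

End Homotopy.

(** * From a stratification to a motion planner *)

Section Strata.
Variables (R : realType) (X : topologicalType) (K : finType) (T : choiceType).
Local Notation E := (X * X)%type.
Variables (kappa : K -> E -> R) (type : E -> T) (grade : T -> nat) (G : nat).
Hypothesis kappa_cts : forall i, continuous (kappa i).
Hypothesis grade_le : forall p, (grade (type p) <= G)%N.
(** The strict inequalities [0 < kappa i p] persist near [p], so the nearby points of the same
    codimension lie in the same stratum. *)
Hypothesis grade_type : forall p p', (forall i, 0 < kappa i p -> 0 < kappa i p') ->
  grade (type p') = grade (type p) -> type p' = type p.
Variable N : T -> set E.
Hypothesis N_open : forall tau, open (N tau).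
Hypothesis N_type : forall p, N (type p) p.
Hypothesis N_planner : forall p, homot R (N (type p)) fst snd.

Let radius : forall p, exists2 rho : R, 0 < rho & forall i, 0 < kappa i p -> rho <= kappa i p.
Proof.
move=> p; have : \forall e \near 0^'+, forall i, 0 < kappa i p -> e <= kappa i p.
  apply: (@filter_forall _ K (fun i => [set e | 0 < kappa i p -> e <= kappa i p])) => i.
  have [kp|kp] := ltP 0 (kappa i p).
    by apply: filterS (nbhs_right_le kp) => e ke _.
  by apply: nearW.
by move=> /(filterI (nbhs_right_gt 0)) /filter_ex[e [e0 eP]]; exists e.
Qed.

(* Two balls of half radius centred at points of the same grade meet only if one of the
   centres is in the full ball of the other, hence only if their types agree. *)
Lemma has_motion_planners_strata : has_motion_planners R X G.+1.
Proof.
have /choice[rho rhoP] : forall p, exists rho : R, 0 < rho /\ forall i, 0 < kappa i p -> rho <= kappa i p.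
  by move=> p; have [rho r0 rP] := radius p; exists rho.
pose B p := [set p' | forall i, `|kappa i p - kappa i p'| < rho p / 2].
have B_open p : open (B p).
  rewrite openE => p' Bp'; rewrite /interior.
  apply: (@filter_forall _ K (fun i => [set p' | `|kappa i p - kappa i p'| < rho p / 2]) (nbhs p') (nbhs_filter p')) => i.
  have kc : {for p', continuous (fun p' => `|kappa i p - kappa i p'|)}.
    by apply: cvg_norm; apply: cvgB; [exact: cst_continuous|exact: kappa_cts].
  by apply: (kc [set x | x < rho p / 2]); exact: lt_nbhsl.
have BB p1 p2 p' : B p1 p' -> B p2 p' -> rho p2 <= rho p1 ->
    forall i, 0 < kappa i p1 -> 0 < kappa i p2.
  move=> B1 B2 r12 i k1; have [_ /(_ i k1)] := rhoP p1.
  move: (B1 i) (B2 i) r12; rewrite !ltr_norml; lra.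
pose O tau := N tau `&` \bigcup_(p in [set p | type p = tau]) B p.
have O_open tau : open (O tau) by apply: openI => //; exact: bigcup_open.
have O_type p : O (type p) p.
  split=> //; exists p => // i; have [r0 _] := rhoP p.
  by rewrite subrr normr0 divr_gt0.
have O_uniq tau tau' p : O tau p -> O tau' p -> grade tau = grade tau' -> tau = tau'.
  move=> [_ [p1 <- B1]] [_ [p2 <- B2]] g12.
  have [r12|/ltW r12] := leP (rho p2) (rho p1).
    by apply/esym/grade_type => //; exact: BB B1 B2 r12.
  by apply/grade_type => //; exact: BB B2 B1 r12.
pose U (c : 'I_G.+1) := \bigcup_(tau in [set tau | grade tau = c]) O tau.
exists U; split.
  apply/seteqP; split => // p _; exists (inord (grade (type p))) => //.
  by exists (type p) => //=; rewrite inordK // ltnS.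
move=> c; split; first exact: bigcup_open.
have /choice[h hP] : forall tau, exists h : E * R -> X, planner (O tau) h.
  move=> tau; have [[p Op]|none] := pselect (exists p, O tau p); last first.
    by exists (fun z => z.1.1); split => [p t Op|p Op|p Op]; case: none; exists p.
  have [_ [p1 <- _]] := Op; have [h [hc h0 h1]] := N_planner p1.
  by exists h; split => [p' t [Np' _]|p' [Np' _]|p' [Np' _]]; [exact: hc|exact: h0|exact: h1].
(* The stratum neighbourhood containing [p] is unique by [O_uniq]; the default is taken only outside
   [U c]. *)
pose tauf p := xget (type p) [set tau | grade tau = c /\ O tau p].
have taufP p tau : grade tau = c -> O tau p -> tauf p = tau.
  move=> gt Op; rewrite /tauf; case: xgetP => [tau' _ [gt' Op']|/(_ tau)]; last by case.
  by apply: O_uniq Op' Op _; rewrite gt gt'.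
apply: (@planner_section _ _ _ (fun z => h (tauf z.1) z)).
split=> [p t [tau gtau Op] t01|p [tau gtau Op]|p [tau gtau Op]].
- have [hc _ _] := hP tau => V /=; rewrite (taufP _ _ gtau Op) => hV.
  have nearO : \forall z \near (p, t), O tau z.1.
    by apply: (@cvg_fst _ _ (nbhs p) (nbhs t) _ (O tau)); exact: open_nbhs_nbhs.
  apply: filterS2 nearO (hc p t Op t01 V hV) => z /= Oz.
  by rewrite (taufP _ _ gtau Oz).
- by rewrite /= (taufP _ _ gtau Op); have [_ h0 _] := hP tau; exact: h0.
- by rewrite /= (taufP _ _ gtau Op); have [_ _ h1] := hP tau; exact: h1.
Qed.

End Strata.

(** * Order types of configurations and their convex cells *)

Section OrderType.
Variables (R : realType) (sigma : R) (L : nat).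
Local Notation C := R[i].
Local Notation Re := (@complex.Re R).
Local Notation Im := (@complex.Im R).
Implicit Types y : 'I_L -> C.

(** The sheared real part; [sigma] is chosen later so that the fixed points have distinct values. *)
Definition ell (z : C) : R := Re z + sigma * Im z.

Lemma ellD z w : ell (z + w) = ell z + ell w.
Proof. by case: z => a b; case: w => c d; rewrite /ell /=; ring. Qed.

Lemma ellZ (t : R) z : ell (t%:C%C * z) = t * ell z.
Proof. by case: z => a b; rewrite /ell /=; ring. Qed.

Lemma ell_Im_inj z w : ell z = ell w -> Im z = Im w -> z = w.
Proof.
case: z => a b; case: w => c d; rewrite /ell /= => ac bd; rewrite bd in ac *.
by move/addIr: ac => ->.
Qed.

(** The lexicographic order by [ell] and [Im], with the pairs separated by [ell] recorded apart from
    those tied and separated by [Im]. *)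
Definition order_type y : {ffun 'I_L * 'I_L -> bool * bool} :=
  [ffun p => (ell (y p.1) < ell (y p.2),
              (ell (y p.1) == ell (y p.2)) && (Im (y p.1) < Im (y p.2)))].

(* Its cardinal is the codimension of the stratum of type [tau]: a class of points with
   the same value of [ell] counts for its size minus one. *)
Definition nonmin (tau : {ffun 'I_L * 'I_L -> bool * bool}) :=
  [set a : 'I_L | [exists b : 'I_L, (b < a)%N && (~~ (tau (a, b)).1 && ~~ (tau (b, a)).1)]]%SET.

Lemma nonminP y (a : 'I_L) :
  reflect (exists2 b : 'I_L, (b < a)%N & ell (y b) = ell (y a))
          (a \in nonmin (order_type y)).
Proof.
rewrite finset.inE; apply: (iffP existsP) => -[b].
  by rewrite !ffunE /= -!leNgt -eq_le => /andP[ba /eqP]; exists b.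
by move=> ba yba; exists b; rewrite ba !ffunE /= yba ltxx.
Qed.

(** Among the first [r] points the values of [ell] are distinct, so none of these is tied with a
    point of smaller index. *)
Lemma nonmin_le (r : nat) (y y0 : 'I_L -> C) : (r <= L)%N ->
  (forall a : 'I_L, (a < r)%N -> y a = y0 a) ->
  (forall a b : 'I_L, (a < r)%N -> (b < r)%N -> ell (y0 a) = ell (y0 b) -> a = b) ->
  (#|nonmin (order_type y)| <= L - r)%N.
Proof.
move=> rL yy0 inj.
have sub : nonmin (order_type y) \subset [set a : 'I_L | (r <= a)%N]%SET.
  apply/fintype.subsetP => a /nonminP[b ba yba]; rewrite finset.inE leqNgt; apply/negP => ar.
  have br : (b < r)%N by exact: ltn_trans ar.
  by move: ba; rewrite (inj b a) ?ltnn // -!yy0.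
apply: leq_trans (subset_leq_card sub) _.
have -> : [set a : 'I_L | (r <= a)%N]%SET = (~: [set widen_ord rL i | i : 'I_r])%SET.
  apply/finset.setP => a; rewrite !finset.inE leqNgt; congr (~~ _); apply/idP/imsetP.
    by move=> ar; exists (Ordinal ar) => //; exact: val_inj.
  by move=> [i _ ->] /=.
rewrite cardsCs finset.setCK card_imset ?card_ord // => i j /(congr1 val) ij.
exact: val_inj.
Qed.

(** Ties of [y'] are ties of [y], so [nonmin] can only shrink. If its size is unchanged, the least
    element of a tie class of [y'] is also least in the class of [y] containing it; hence the
    classes coincide, and the strict inequalities determine the rest. *)
Lemma order_type_semicontinuous y y' :
  injective y ->
  (forall a b, ell (y a) < ell (y b) -> ell (y' a) < ell (y' b)) ->
  (forall a b, Im (y a) < Im (y b) -> Im (y' a) < Im (y' b)) ->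
  (#|nonmin (order_type y')| <= #|nonmin (order_type y)|)%N /\
  (#|nonmin (order_type y')| = #|nonmin (order_type y)| -> order_type y' = order_type y).
Proof.
move=> y_inj ylt yIm.
have eqE a b : ell (y' a) = ell (y' b) -> ell (y a) = ell (y b).
  move=> e; apply/eqP; rewrite eq_le !leNgt.
  by apply/andP; split; apply/negP => /ylt; rewrite e ltxx.
have sub : nonmin (order_type y') \subset nonmin (order_type y).
  apply/fintype.subsetP => a /nonminP[b ba /eqE yba]; apply/nonminP; by exists b.
split; first exact: subset_leq_card.
move=> /eqP; rewrite eq_sym => /eqP card_eq.
have nmE : nonmin (order_type y') = nonmin (order_type y).
  by apply/eqP; rewrite eqEcard sub card_eq leqnn.
have ex_min a : exists m : 'I_L, [/\ ell (y' m) = ell (y' a) &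
    forall b : 'I_L, ell (y b) = ell (y a) -> (m <= b)%N].
  have [m /eqP ma mmin] := @arg_minnP _ a (fun m => ell (y' m) == ell (y' a)) (fun m => m) (eqxx _).
  exists m; split => // b yba; rewrite leqNgt; apply/negP => bm.
  have : m \in nonmin (order_type y).
    by apply/nonminP; exists b => //; rewrite yba; exact/esym/eqE.
  rewrite -nmE => /nonminP[b' b'm b'E].
  by have := mmin b'; rewrite b'E ma eqxx leqNgt b'm => /(_ isT).
have eqE' a b : ell (y a) = ell (y b) -> ell (y' a) = ell (y' b).
  move=> yab; have [m [ma mmin]] := ex_min a; have [m' [mb m'min]] := ex_min b.
  rewrite -ma -mb; congr (ell (y' _)); apply/val_inj/eqP; rewrite /= eqn_leq.
  rewrite m'min; last by rewrite -yab; exact: eqE.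
  by rewrite mmin //; rewrite yab; exact: eqE.
apply/ffunP => -[a b]; rewrite !ffunE /=.
have ltE c d : (ell (y' c) < ell (y' d)) = (ell (y c) < ell (y d)).
  case: (ltgtP (ell (y c)) (ell (y d))) => [/ylt ->//|/ylt/ltW|/eqE' ->].
    by rewrite leNgt => /negbTE.
  by rewrite ltxx.
congr pair; first exact: ltE.
have -> : (ell (y' a) == ell (y' b)) = (ell (y a) == ell (y b)).
  by apply/eqP/eqP; [exact: eqE|exact: eqE'].
case: eqVneq => //= yab.
case: (ltgtP (Im (y a)) (Im (y b))) => [/yIm ->//|/yIm/ltW|iab].
  by rewrite leNgt => /negbTE.
by rewrite (y_inj _ _ (ell_Im_inj yab iab)) ltxx.
Qed.

(** Only the strict inequalities are imposed, not the ties: this gives a convex open neighbourhood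
    of the stratum. *)
Definition cell (tau : {ffun 'I_L * 'I_L -> bool * bool}) y :=
  forall a b, ((tau (a, b)).1 -> ell (y a) < ell (y b)) /\
              ((tau (a, b)).2 -> Im (y a) < Im (y b)).

Lemma cell_order_type y : cell (order_type y) y.
Proof. by move=> a b; rewrite !ffunE /=; split => // /andP[]. Qed.

Lemma cell_injective y0 y : injective y0 -> cell (order_type y0) y -> injective y.
Proof.
move=> inj0 yc a b yab; apply/eqP; apply: contraTT isT => ab.
have [c1 c2] := yc a b; have [d1 d2] := yc b a.
move: c1 c2 d1 d2; rewrite !ffunE /= yab !ltxx.
case: (ltgtP (ell (y0 a)) (ell (y0 b))) => [|_ _ _ /(_ isT)//|eab].
  by move=> _ /(_ isT).
case: (ltgtP (Im (y0 a)) (Im (y0 b))) => [_ _ /(_ isT)//|_ _ _ _ /(_ isT)//|iab].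
by move: ab; rewrite (inj0 _ _ (ell_Im_inj eab iab)) eqxx.
Qed.

Definition mix (t : R) (z w : C) : C := (1 - t)%:C%C * z + t%:C%C * w.

Lemma mix0 z w : mix 0 z w = z.
Proof. by rewrite /mix subr0 mul1r mul0r addr0. Qed.

Lemma mix1 z w : mix 1 z w = w.
Proof. by rewrite /mix subrr mul0r add0r mul1r. Qed.

Lemma mixx t z : mix t z z = z.
Proof. by rewrite /mix -mulrDl -rmorphD /= subrK mul1r. Qed.

Lemma cell_mix tau y y' t : 0 <= t <= 1 -> cell tau y -> cell tau y' ->
  cell tau (fun a => mix t (y a) (y' a)).
Proof.
move=> /andP[t0 t1] yc y'c a b; have [c1 c2] := yc a b; have [d1 d2] := y'c a b.
have convex (x x' z z' : R) : x < x' -> z < z' ->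
    (1 - t) * x + t * z < (1 - t) * x' + t * z'.
  move=> xx' zz'; have [->|tN0] := eqVneq t 0; first lra.
  have tpos : 0 < t by rewrite lt0r tN0.
  by apply: ler_ltD; [rewrite ler_wpM2l ?subr_ge0 // ltW|rewrite ltr_pM2l].
have ImE z w : Im (mix t z w) = (1 - t) * Im z + t * Im w.
  by case: z => ? ?; case: w => ? ?; rewrite /mix /=; ring.
split=> [/[dup]/c1 h /d1 k|/[dup]/c2 h /d2 k]; last by rewrite !ImE convex.
by rewrite /mix !ellD !ellZ convex.
Qed.

End OrderType.

(** * Paths between configurations *)

Section Connectivity.
Variables (R : realType) (L : nat).
Local Notation C := R[i].
Local Notation Re := (@complex.Re R).
Local Notation Im := (@complex.Im R).

Lemma avoid_finite (K : finType) (f : K -> R) : exists s : R, forall i, s != f i.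
Proof.
exists (1 + \sum_i `|f i|) => i; rewrite gt_eqF //.
rewrite (bigD1 i) //=; apply: le_lt_trans (ler_norm _) _.
rewrite addrCA ltrDl; apply: ltr_pwDl => //; exact: sumr_ge0.
Qed.

Definition arc (s t : R) : C := (t +i* (s * (t * (1 - t))))%C.

(* A complex line through two configurations meets the diagonals in finitely many
   points, and each of them lies on at most one of the arcs joining [0] to [1]. *)
Lemma config_arc (y y' : 'I_L -> C) : injective y -> injective y' ->
  exists s : R, forall t, injective (fun a => y a + arc s t * (y' a - y a)).
Proof.
move=> yi y'i.
(* The complex time at which the points [p.1] and [p.2] would meet; [s] is then chosen so that the
   arc misses all these times. *)
pose om (p : 'I_L * 'I_L) := (y p.1 - y p.2) / ((y p.1 - y p.2) - (y' p.1 - y' p.2)).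
have [s sP] := @avoid_finite _ (fun p => Im (om p) / (Re (om p) * (1 - Re (om p)))).
exists s => t a b E; apply/eqP; apply: contraTT isT => ab.
have d0 : y a - y b != 0 by rewrite subr_eq0 (inj_eq yi).
have d0' : y' a - y' b != 0 by rewrite subr_eq0 (inj_eq y'i).
set d := y a - y b in d0; set d' := y' a - y' b in d0'.
have E0 : d + arc s t * (d' - d) = 0.
  by rewrite /d /d'; move/eqP: E; rewrite -subr_eq0 => /eqP <-; ring.
have dd' : d - d' != 0.
  apply: contra_neq d0 => /eqP; rewrite subr_eq0 => /eqP dd'.
  by move: E0; rewrite -dd' subrr mulr0 addr0.
have omE : arc s t = om (a, b).
  rewrite /om /= -/d -/d'; apply: (mulIf dd'); rewrite divfK //.
  by apply/eqP; rewrite -subr_eq0 -oppr_eq0 -E0; apply/eqP; ring.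
have ReE : Re (om (a, b)) = t by rewrite -omE.
have ImE : Im (om (a, b)) = s * (t * (1 - t)) by rewrite -omE.
have t0 : t != 0.
  apply: contra_neq d0 => t0; move: E0.
  by rewrite /arc t0 mul0r mulr0 [_ * _](mul0r (d' - d)) addr0.
have t1 : 1 - t != 0.
  rewrite subr_eq0; apply: contra_neq d0' => t1; move: E0.
  by rewrite /arc -t1 subrr !mulr0 [_ * _](mul1r (d' - d)) addrC subrK.
have := sP (a, b); rewrite ReE ImE mulfK ?eqxx //.
by rewrite mulf_neq0.
Qed.

End Connectivity.

(** * Motion planners for normalized configurations *)

Section Upper.
Variables (R : realType) (X : topologicalType) (q : seq R[i]) (n : nat).
Local Notation C := R[i].
Local Notation Re := (@complex.Re R).
Local Notation Im := (@complex.Im R).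
Variable ch : chart X q n.

(* A configuration is written [cf x + zf x * Y x (phi i)], where the first [r] points of
   [Y x] are those of [y0]; [rot] tells whether the factor [zf x] is allowed to vary. *)
Variables (L r : nat) (y0 : 'I_L -> C) (rot : bool) (phi : 'I_n -> 'I_L) (sigma : R).
Hypothesis rL : (r <= L)%N.
Hypothesis ell_inj : forall a b : 'I_L, (a < r)%N -> (b < r)%N ->
  ell sigma (y0 a) = ell sigma (y0 b) -> a = b.
Variables (cf zf : X -> C) (Y : X -> 'I_L -> C) (cP : C -> Prop).
Hypothesis cf_cts : forall x, cts_at cf x.
Hypothesis zf_cts : forall x, cts_at zf x.
Hypothesis Y_cts : forall a x, cts_at (Y^~ a) x.

Definition normalized (y : 'I_L -> C) :=
  injective y /\ forall a : 'I_L, (a < r)%N -> y a = y0 a.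

Definition scaling (z : C) := z != 0 /\ (rot \/ z = 1).

Hypothesis Y_normalized : forall x, normalized (Y x).
Hypothesis zf_scaling : forall x, scaling (zf x).
Hypothesis cf_cP : forall x, cP (cf x).
(** In the applications [cP] is equality to a constant or no condition at all, so translations can
    be joined by segments. *)
Hypothesis cP_mix : forall c c' t, cP c -> cP c' -> cP (mix t c c').

Definition recf (c z : C) (y : 'I_L -> C) : 'I_n -> C := fun i => c + z * y (phi i).

Hypothesis rec_valid : forall c z y,
  cP c -> scaling z -> normalized y -> valid q (recf c z y).
Hypothesis recK : forall x, recf (cf x) (zf x) (Y x) = pc ch x.

Local Notation E := (X * X)%type.

Lemma homot_rec (N : set E) (c z : E * R -> C) (y : E * R -> 'I_L -> C) :
  (forall p t, N p -> 0 <= t <= 1 -> [/\ cts_at c (p, t), cts_at z (p, t) &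
     forall a, cts_at (y^~ a) (p, t)]) ->
  (forall p t, N p -> 0 <= t <= 1 ->
     [/\ cP (c (p, t)), scaling (z (p, t)) & normalized (y (p, t))]) ->
  homot R N (fun p => mk ch (recf (c (p, 0)) (z (p, 0)) (y (p, 0))))
            (fun p => mk ch (recf (c (p, 1)) (z (p, 1)) (y (p, 1)))).
Proof.
move=> cts ok; exists (fun w => mk ch (recf (c w) (z w) (y w))); split => //.
move=> p t Np t01; have [c1 c2 c3] := ok p t Np t01; have [d1 d2 d3] := cts p t Np t01.
apply: (@mk_cts _ _ _ _ ch _ (fun w => recf (c w) (z w) (y w))); first exact: rec_valid.
by move=> i; exact: cts_atD d1 (cts_atM d2 (d3 _)).
Qed.

Lemma cts_fst (f : X -> C) (w : E * R) : cts_at f w.1.1 -> cts_at (fun w => f w.1.1) w.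
Proof.
move=> cf'; apply: (cts_at_comp (f := f) (g := fun w : E * R => w.1.1)) => //.
by apply: (@continuous_comp _ _ _ fst fst); exact: cvg_fst.
Qed.

Lemma cts_snd (f : X -> C) (w : E * R) : cts_at f w.1.2 -> cts_at (fun w => f w.1.2) w.
Proof.
move=> cf'; apply: (cts_at_comp (f := f) (g := fun w : E * R => w.1.2)) => //.
by apply: (@continuous_comp _ _ _ fst snd); [exact: cvg_fst|exact: cvg_snd].
Qed.

Lemma cts_Y_fst a (w : E * R) : cts_at (fun w => Y w.1.1 a) w.
Proof. exact: (cts_fst (f := Y^~ a)). Qed.

Lemma cts_Y_snd a (w : E * R) : cts_at (fun w => Y w.1.2 a) w.
Proof. exact: (cts_snd (f := Y^~ a)). Qed.

Lemma cts_time (w : E * R) : {for w, continuous (fun w : E * R => w.2)}.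
Proof. exact: cvg_snd. Qed.

Lemma cts_mix (f g : E * R -> C) w : cts_at f w -> cts_at g w ->
  cts_at (fun w => mix w.2 (f w) (g w)) w.
Proof.
move=> cf' cg.
have c1 : {for w, continuous (fun w : E * R => 1 - w.2)}.
  by apply: cvgB; [exact: cst_continuous|exact: cts_time].
exact: cts_atD (cts_atM (cts_at_real c1) cf') (cts_atM (cts_at_real (@cts_time w)) cg).
Qed.

Lemma normalized_mix x0 y y' t : 0 <= t <= 1 -> normalized y -> normalized y' ->
  cell sigma (order_type sigma (Y x0)) y -> cell sigma (order_type sigma (Y x0)) y' ->
  normalized (fun a => mix t (y a) (y' a)).
Proof.
move=> t01 [_ yr] [_ y'r] yc y'c; split.
  by apply: (cell_injective (sigma := sigma) (y0 := Y x0)) (cell_mix _ _ _); have [] := Y_normalized x0.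
by move=> a ar; rewrite yr // y'r // mixx.
Qed.

Lemma normalized_arc x x' s t :
  injective (fun a => Y x a + arc s t * (Y x' a - Y x a)) ->
  normalized (fun a => Y x a + arc s t * (Y x' a - Y x a)).
Proof.
split=> // a ar; have [_ ->//] := Y_normalized x; have [_ ->//] := Y_normalized x'.
by rewrite subrr mulr0 addr0.
Qed.

(** For nonzero [z], this means that [w] is a negative real multiple of [z]; for nonzero [z] and [w]
    it is the only case where the segment between them meets 0. *)
Definition opposite (z w : C) := (Im (z^*%C * w) == 0) && (Re (z^*%C * w) < 0).

Lemma opposite_mix z w t : 0 <= t <= 1 -> z != 0 -> w != 0 -> ~~ opposite z w ->
  mix t z w != 0.
Proof.
move=> /andP[t0 t1] z0 w0; apply: contra => /eqP zw0; rewrite /opposite.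
have : z^*%C * mix t z w = 0 by rewrite zw0 mulr0.
have zz : 0 < Re z ^+ 2 + Im z ^+ 2 by rewrite lt0r normc2_neq0 // addr_ge0 ?sqr_ge0.
have zw : z^*%C * w != 0 by rewrite mulf_neq0 ?conjc_eq0.
have -> : z^*%C * mix t z w =
    ((1 - t) * (Re z ^+ 2 + Im z ^+ 2))%:C%C + t%:C%C * (z^*%C * w).
  rewrite /mix rmorphM /=; case: (z) => a b; case: (w) => c d; apply/eqP.
  by rewrite eq_complex /=; apply/andP; split; apply/eqP; ring.
move: zz zw; set n2 := Re z ^+ 2 + _; case: (z^*%C * w) => a b /= n20 ab0 /eqP.
rewrite eq_complex /= !mul0r subr0 addr0 add0r => /andP[/eqP hre /eqP him].
have tN0 : t != 0.
  by apply: contraTneq n20 => te; move: hre; rewrite te; lra.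
have tpos : 0 < t by rewrite lt0r tN0.
have b0 : b = 0 by apply: (mulfI tN0); rewrite mulr0.
rewrite b0 eqxx /=; have aN0 : a != 0.
  by apply: contraNneq ab0 => ->; rewrite b0.
rewrite lt_neqAle aN0 /=; rewrite -(ler_pM2l tpos) mulr0.
have : 0 <= (1 - t) * n2 by rewrite mulr_ge0 ?subr_ge0 // ltW.
lra.
Qed.

Lemma oppositeN z w : opposite z w -> ~~ opposite (- z) w.
Proof.
case: z => a b; case: w => c d; rewrite /opposite /= => /andP[_ h].
rewrite negb_and -leNgt; apply/orP; right; lra.
Qed.

Let tyT := ({ffun 'I_L * 'I_L -> bool * bool} * {ffun 'I_L * 'I_L -> bool * bool} * bool)%type.

Definition motion_type (p : E) : tyT :=
  (order_type sigma (Y p.1), order_type sigma (Y p.2), opposite (zf p.1) (zf p.2)).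

Definition motion_grade (tau : tyT) :=
  (#|nonmin tau.1.1| + #|nonmin tau.1.2| + tau.2)%N.

(** Between opposite scalings the motion starts with a half turn, so the segment to [zf p.2] starts
    at [- zf p.1]. *)
Definition motion_cell (tau : tyT) : set E := [set p |
  [/\ cell sigma tau.1.1 (Y p.1), cell sigma tau.1.2 (Y p.2) &
      if tau.2 then ~~ opposite (- zf p.1) (zf p.2) else ~~ opposite (zf p.1) (zf p.2)]].

Let mkE x := mk ch (recf (cf x) (zf x) (Y x)).

Lemma mkEE x : mkE x = x.
Proof. by rewrite /mkE recK pcK. Qed.

Lemma homot_eq (N : set E) (a b a' b' : E -> X) : a = a' -> b = b' ->
  homot R N a b -> homot R N a' b'.
Proof. by move=> -> ->. Qed.

(** [Y p.1] goes linearly to the base point [Y p0.1], then along an arc to [Y p0.2], then linearly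
    to [Y p.2]; after that the scaling is moved, and finally the translation. *)
Lemma motion_planner p0 : homot R (motion_cell (motion_type p0)) fst snd.
Proof.
set N := motion_cell _.
have Nc (p : E) : N p -> [/\ cell sigma (order_type sigma (Y p0.1)) (Y p.1),
    cell sigma (order_type sigma (Y p0.2)) (Y p.2) &
    if opposite (zf p0.1) (zf p0.2) then ~~ opposite (- zf p.1) (zf p.2)
    else ~~ opposite (zf p.1) (zf p.2)] by [].
pose s1 (p : E) := mk ch (recf (cf p.1) (zf p.1) (Y p0.1)).
pose s2 (p : E) := mk ch (recf (cf p.1) (zf p.1) (Y p0.2)).
pose s3 (p : E) := mk ch (recf (cf p.1) (zf p.1) (Y p.2)).
pose s4 (p : E) := mk ch (recf (cf p.1) (zf p.2) (Y p.2)).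
have h1 : homot R N fst s1.
  apply: homot_eq (homot_rec (N := N) (c := fun w => cf w.1.1) (z := fun w => zf w.1.1)
    (y := fun w a => mix w.2 (Y w.1.1 a) (Y p0.1 a)) _ _).
  - apply/funext => p /=; rewrite -[RHS]mkEE; congr (mk ch (recf _ _ _)).
    by apply/funext => a; rewrite mix0.
  - apply/funext => p /=; congr (mk ch (recf _ _ _)).
    by apply/funext => a; rewrite mix1.
  - move=> p t _ _; split; [exact: cts_fst|exact: cts_fst|move=> a].
    by apply: cts_mix; [exact: cts_Y_fst|exact: cts_at_cst].
  - move=> p t /Nc[c1 _ _] t01; split => //=.
    by apply: (normalized_mix (x0 := p0.1)) => //; exact: cell_order_type.
have h2 : homot R N s1 s2.
  have [i0 _] := Y_normalized p0.1; have [i0' _] := Y_normalized p0.2.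
  have [s sP] := config_arc i0 i0'.
  apply: homot_eq (homot_rec (N := N) (c := fun w => cf w.1.1) (z := fun w => zf w.1.1)
    (y := fun w a => Y p0.1 a + arc s w.2 * (Y p0.2 a - Y p0.1 a)) _ _).
  - apply/funext => p /=; congr (mk ch (recf _ _ _)); apply/funext => a.
    by rewrite /arc mul0r mulr0 [_ * (_ - _)](mul0r (Y p0.2 a - Y p0.1 a)) addr0.
  - apply/funext => p /=; congr (mk ch (recf _ _ _)); apply/funext => a.
    by rewrite /arc subrr !mulr0 [_ * (_ - _)](mul1r (Y p0.2 a - Y p0.1 a)) addrC subrK.
  - move=> p t _ _; split; [exact: cts_fst|exact: cts_fst|move=> a].
    apply: cts_atD; first exact: cts_at_cst.
    apply: cts_atM; last exact: cts_at_cst.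
    have ct := @cts_time (p, t); split => //=.
    apply: cvgM; first exact: cst_continuous.
    by apply: cvgM => //; apply: cvgB => //; exact: cst_continuous.
  - by move=> p t _ t01; split => //=; exact: normalized_arc.
have h3 : homot R N s2 s3.
  apply: homot_eq (homot_rec (N := N) (c := fun w => cf w.1.1) (z := fun w => zf w.1.1)
    (y := fun w a => mix w.2 (Y p0.2 a) (Y w.1.2 a)) _ _).
  - apply/funext => p /=; congr (mk ch (recf _ _ _)).
    by apply/funext => a; rewrite mix0.
  - apply/funext => p /=; congr (mk ch (recf _ _ _)).
    by apply/funext => a; rewrite mix1.
  - move=> p t _ _; split; [exact: cts_fst|exact: cts_fst|move=> a].
    by apply: cts_mix; [exact: cts_at_cst|exact: cts_Y_snd].
  - move=> p t /Nc[_ c2 _] t01; split => //=.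
    by apply: (normalized_mix (x0 := p0.2)) => //; exact: cell_order_type.
have h4 : homot R N s3 s4.
  case: (boolP (opposite (zf p0.1) (zf p0.2))) => [op|nop].
    have rotT : rot = true.
      have [_ [//|e1]] := zf_scaling p0.1; have [_ [//|e2]] := zf_scaling p0.2.
      by move: op; rewrite e1 e2 /opposite conjc1 mulr1 /= ltr10 andbF.
    pose s5 (p : E) := mk ch (recf (cf p.1) (- zf p.1) (Y p.2)).
    apply: (@homot_trans _ _ _ _ _ s5).
      apply: homot_eq (homot_rec (N := N) (c := fun w => cf w.1.1)
        (z := fun w => zf w.1.1 * expi (pi * w.2)) (y := fun w => Y w.1.2) _ _).
      - by apply/funext => p /=; rewrite mulr0 expi0 mulr1.
      - apply/funext => p /=; rewrite mulr1.
        have -> : expi pi = -1 :> C.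
          by apply/eqP; rewrite eq_complex /= cospi sinpi oppr0 !eqxx.
        by rewrite mulrN1.
      - move=> p t _ _; split; [exact: cts_fst| |move=> a; exact: cts_Y_snd].
        apply: cts_atM; first exact: cts_fst.
        apply: (cts_at_comp (f := @expi R)); first exact: continuous_expi.
        by apply: cvgM; [exact: cst_continuous|exact: cts_time].
      - move=> p t _ _; split => //=; split; last by left.
        by rewrite mulf_neq0 ?expi_neq0 //; have [] := zf_scaling p.1.
    apply: homot_eq (homot_rec (N := N) (c := fun w => cf w.1.1)
      (z := fun w => mix w.2 (- zf w.1.1) (zf w.1.2)) (y := fun w => Y w.1.2) _ _).
    - by apply/funext => p /=; rewrite mix0.
    - by apply/funext => p /=; rewrite mix1.
    - move=> p t _ _; split; [exact: cts_fst| |move=> a; exact: cts_Y_snd].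
      by apply: cts_mix; [apply: cts_atN; exact: cts_fst|exact: cts_snd].
    - move=> p t /Nc[_ _]; rewrite op => nop t01; split => //=; split; last by left.
      apply: opposite_mix => //; first by rewrite oppr_eq0; have [] := zf_scaling p.1.
      by have [] := zf_scaling p.2.
  apply: homot_eq (homot_rec (N := N) (c := fun w => cf w.1.1)
    (z := fun w => mix w.2 (zf w.1.1) (zf w.1.2)) (y := fun w => Y w.1.2) _ _).
  - by apply/funext => p /=; rewrite mix0.
  - by apply/funext => p /=; rewrite mix1.
  - move=> p t _ _; split; [exact: cts_fst| |move=> a; exact: cts_Y_snd].
    by apply: cts_mix; [exact: cts_fst|exact: cts_snd].
  - move=> p t /Nc[_ _]; rewrite (negbTE nop) => nop' t01; split => //=.
    have [z1 o1] := zf_scaling p.1; have [z2 o2] := zf_scaling p.2.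
    split; first exact: opposite_mix.
    case: o1 => [|e1]; first by left.
    case: o2 => [|e2]; first by left.
    by right; rewrite e1 e2 mixx.
have h5 : homot R N s4 snd.
  apply: homot_eq (homot_rec (N := N) (c := fun w => mix w.2 (cf w.1.1) (cf w.1.2))
    (z := fun w => zf w.1.2) (y := fun w => Y w.1.2) _ _).
  - by apply/funext => p /=; rewrite mix0.
  - by apply/funext => p /=; rewrite mix1 -[RHS]mkEE.
  - move=> p t _ _; split; [|exact: cts_snd|move=> a; exact: cts_Y_snd].
    by apply: cts_mix; [exact: cts_fst|exact: cts_snd].
  - by move=> p t _ t01; split => //=; exact: cP_mix.
exact: homot_trans h1 (homot_trans h2 (homot_trans h3 (homot_trans h4 h5))).
Qed.

Let index := (bool * ('I_L * 'I_L) * bool + bool * bool)%type.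

Definition motion_kappa (k : index) (p : E) : R := match k with
  | inl (s, (a, b), l) => let x := if s then p.1 else p.2 in
      let f := if l then ell sigma else Im in f (Y x b) - f (Y x a)
  | inr (s, l) => let x := (zf p.1)^*%C * zf p.2 in
      let f := if l then Re else Im in if s then f x else - f x end.

Lemma motion_kappa_cts k : continuous (motion_kappa k).
Proof.
have cY1 a p : cts_at (fun p : E => Y p.1 a) p.
  by apply: (cts_at_comp (f := Y^~ a) (g := fst)) => //; exact: cvg_fst.
have cY2 a p : cts_at (fun p : E => Y p.2 a) p.
  by apply: (cts_at_comp (f := Y^~ a) (g := snd)) => //; exact: cvg_snd.
have cz1 p : cts_at (fun p : E => zf p.1) p.
  by apply: (cts_at_comp (f := zf) (g := fst)) => //; exact: cvg_fst.
have cz2 p : cts_at (fun p : E => zf p.2) p.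
  by apply: (cts_at_comp (f := zf) (g := snd)) => //; exact: cvg_snd.
have cell (f : E -> C) p : cts_at f p -> {for p, continuous (fun p => ell sigma (f p))}.
  by move=> [f1 f2]; apply: cvgD => //; apply: cvgM => //; exact: cst_continuous.
have cIm p : {for p, continuous (fun p : E => Im ((zf p.1)^*%C * zf p.2))}.
  have E1 (z w : C) : Im (z^*%C * w) = Re z * Im w - Im z * Re w.
    by case: z => a b; case: w => c d /=; ring.
  rewrite (_ : (fun p => _) = fun p : E => Re (zf p.1) * Im (zf p.2) - Im (zf p.1) * Re (zf p.2)).
    by have [? ?] := cz1 p; have [? ?] := cz2 p; apply: cvgB; apply: cvgM.
  by apply/funext => p'; rewrite E1.
have cRe p : {for p, continuous (fun p : E => Re ((zf p.1)^*%C * zf p.2))}.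
  have E1 (z w : C) : Re (z^*%C * w) = Re z * Re w + Im z * Im w.
    by case: z => a b; case: w => c d /=; ring.
  rewrite (_ : (fun p => _) = fun p : E => Re (zf p.1) * Re (zf p.2) + Im (zf p.1) * Im (zf p.2)).
    by have [? ?] := cz1 p; have [? ?] := cz2 p; apply: cvgD; apply: cvgM.
  by apply/funext => p'; rewrite E1.
move=> p; case: k => [[[s [a b]] l]|[s l]].
- case: s; case: l.
  + by apply: (@cvgB _ _ _ _ _ (fun p => ell sigma (Y p.1 b)) (fun p => ell sigma (Y p.1 a))); apply: cell.
  + have [_ Yb] := cY1 b p; have [_ Ya] := cY1 a p.
    exact: (@cvgB _ _ _ _ _ (fun p => Im (Y p.1 b)) (fun p => Im (Y p.1 a)) _ _ Yb Ya).
  + by apply: (@cvgB _ _ _ _ _ (fun p => ell sigma (Y p.2 b)) (fun p => ell sigma (Y p.2 a))); apply: cell.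
  + have [_ Yb] := cY2 b p; have [_ Ya] := cY2 a p.
    exact: (@cvgB _ _ _ _ _ (fun p => Im (Y p.2 b)) (fun p => Im (Y p.2 a)) _ _ Yb Ya).
- case: s; case: l; [exact: cRe|exact: cIm| |].
    exact: (@cvgN _ _ _ _ _ (fun p : E => Re ((zf p.1)^*%C * zf p.2)) _ (cRe p)).
  exact: (@cvgN _ _ _ _ _ (fun p : E => Im ((zf p.1)^*%C * zf p.2)) _ (cIm p)).
Qed.

(** The relative scaling is nonzero: either its imaginary part is nonzero and stays so, or its real
    part is nonzero and keeps its sign. *)
Lemma opposite_kappa p p' : (forall i, 0 < motion_kappa i p -> 0 < motion_kappa i p') ->
  (opposite (zf p'.1) (zf p'.2) -> opposite (zf p.1) (zf p.2)) /\
  (opposite (- zf p'.1) (zf p'.2) -> opposite (- zf p.1) (zf p.2)).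
Proof.
move=> pp'.
have zw : (zf p.1)^*%C * zf p.2 != 0.
  have [z1 _] := zf_scaling p.1; have [z2 _] := zf_scaling p.2.
  by rewrite mulf_neq0 ?conjc_eq0.
have := (pp' (inr (true, true)), pp' (inr (true, false)),
  pp' (inr (false, true)), pp' (inr (false, false))).
rewrite /motion_kappa /opposite !rmorphN !mulNr; move: zw.
case: ((zf p.1)^*%C * zf p.2) => a b; case: ((zf p'.1)^*%C * zf p'.2) => a' b' /=.
rewrite eq_complex /= !oppr_gt0 !oppr_eq0 !oppr_lt0 => ab0 [[[apos bpos] aneg] bneg].
case: (ltgtP b 0) => [/bneg b'0|/bpos b'0|b0] /=.
- by rewrite (lt_eqF b'0).
- by rewrite (gt_eqF b'0).
case: (ltgtP a 0) => [/aneg a'0|/apos a'0|a0].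
- by split => //; rewrite [0 < a']ltNge (ltW a'0) andbF.
- by split => //; rewrite [a' < 0]ltNge (ltW a'0) andbF.
by move: ab0; rewrite a0 b0 eqxx.
Qed.

Lemma lt_kappa p p' : (forall i, 0 < motion_kappa i p -> 0 < motion_kappa i p') ->
  forall (s l : bool) a b, let f := if l then ell sigma else Im in
    f (Y (if s then p.1 else p.2) a) < f (Y (if s then p.1 else p.2) b) ->
    f (Y (if s then p'.1 else p'.2) a) < f (Y (if s then p'.1 else p'.2) b).
Proof.
by move=> pp' s l a b f h; have := pp' (inl (s, (a, b), l)); rewrite /= !subr_gt0; exact.
Qed.

(** None of the three terms of the grade can increase from [p] to [p'], so equal sums force equality
    of each term. *)
Lemma motion_grade_type p p' : (forall i, 0 < motion_kappa i p -> 0 < motion_kappa i p') ->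
  motion_grade (motion_type p') = motion_grade (motion_type p) ->
  motion_type p' = motion_type p.
Proof.
move=> pp'.
have ltY := lt_kappa pp'.
have [i1 _] := Y_normalized p.1; have [i2 _] := Y_normalized p.2.
have [le1 eq1] := order_type_semicontinuous i1 (ltY true true) (ltY true false).
have [le2 eq2] := order_type_semicontinuous i2 (ltY false true) (ltY false false).
have [op _] := opposite_kappa pp'.
rewrite /motion_grade /motion_type /=.
set A' := #|nonmin (order_type sigma (Y p'.1))| in le1 eq1 *.
set A := #|nonmin (order_type sigma (Y p.1))| in le1 eq1 *.
set B' := #|nonmin (order_type sigma (Y p'.2))| in le2 eq2 *.
set B := #|nonmin (order_type sigma (Y p.2))| in le2 eq2 *.
set o' := opposite _ _ in op *; set o := opposite _ _ in op *.
have le3 : (o' <= o)%N by case: o' op => // /(_ isT) ->.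
move=> gE.
have e1 : A' = A by lia.
have e2 : B' = B by lia.
have e3 : o' = o :> nat by lia.
by rewrite eq1 // eq2 //; congr (_, _, _); move: e3; case: (o') => //; case: (o).
Qed.

Lemma motion_grade_le p : (motion_grade (motion_type p) <= 2 * (L - r) + rot)%N.
Proof.
rewrite /motion_grade /motion_type /= mul2n -addnn.
have bound x : (#|nonmin (order_type sigma (Y x))| <= L - r)%N.
  by apply: (nonmin_le (y0 := y0)) => //; have [] := Y_normalized x.
rewrite leq_add // ?leq_add //.
case: (boolP (opposite _ _)) => // op.
have [_ [->//|e1]] := zf_scaling p.1; have [_ [->//|e2]] := zf_scaling p.2.
by move: op; rewrite e1 e2 /opposite conjc1 mulr1 /= ltr10 andbF.
Qed.

Lemma motion_cell_open tau : open (motion_cell tau).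
Proof.
rewrite openE => p [c1 c2 op]; rewrite /interior.
have : \forall p' \near p, forall i, 0 < motion_kappa i p -> 0 < motion_kappa i p'.
  apply: (@filter_forall _ index (fun i => [set p' | 0 < motion_kappa i p -> 0 < motion_kappa i p'])
    (nbhs p) (nbhs_filter p)) => i.
  have [kp|kp] := ltP 0 (motion_kappa i p); last exact: nearW.
  have kc : {for p, continuous (motion_kappa i)} by exact: motion_kappa_cts.
  by apply: filterS (near_gt0 kc kp) => p' h _.
apply: filterS => p' pp'.
have ltY := lt_kappa pp'.
have [op1 op2] := opposite_kappa pp'.
split=> [a b|a b|].
- by have [d1 d2] := c1 a b; split => [/d1/(ltY true true)|/d2/(ltY true false)].
- by have [d1 d2] := c2 a b; split => [/d1/(ltY false true)|/d2/(ltY false false)].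
- by case: ifP op => _; apply: contra.
Qed.

Lemma motion_cell_type p : motion_cell (motion_type p) p.
Proof.
split; [exact: cell_order_type|exact: cell_order_type|].
by rewrite /=; case: ifP => [|->//]; exact: oppositeN.
Qed.

Theorem has_motion_planners_normalized :
  has_motion_planners R X (2 * (L - r) + rot).+1.
Proof.
apply: (@has_motion_planners_strata R X index tyT motion_kappa motion_type motion_grade
  _ motion_kappa_cts motion_grade_le motion_grade_type motion_cell motion_cell_open
  motion_cell_type motion_planner).
Qed.

End Upper.

(** * Upper bounds for each number of punctures *)

Section UpperCases.
Variables (R : realType) (X : topologicalType) (q : seq R[i]) (n : nat).
Local Notation C := R[i].
Local Notation Re := (@complex.Re R).
Local Notation Im := (@complex.Im R).
Variable ch : chart X q n.

(** The shear avoids the finitely many values that would tie two punctures with distinct imaginary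
    parts; punctures with equal imaginary parts differ in their real parts. *)
Lemma ell_generic : uniq q -> exists sigma : R, forall a b : nat,
  (a < size q)%N -> (b < size q)%N -> ell sigma q`_a = ell sigma q`_b -> a = b.
Proof.
move=> uq.
have [s sP] := @avoid_finite R _ (fun p : 'I_(size q) * 'I_(size q) =>
  - Re (q`_p.1 - q`_p.2) / Im (q`_p.1 - q`_p.2)).
exists s => a b aq bq E; apply/eqP; rewrite -(nth_uniq 0 aq bq uq) -subr_eq0.
have := sP (Ordinal aq, Ordinal bq); rewrite /=.
have : ell s (q`_a - q`_b) = 0.
  have := ellD s (q`_a - q`_b) q`_b; rewrite subrK E; lra.
case: (q`_a - q`_b) => x y; rewrite /ell /= => xy sxy.
have y0 : y == 0.
  apply: contraNT sxy => y0; apply/eqP/(mulIf y0); rewrite divfK //; lra.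
by move: xy; rewrite eq_complex /= (eqP y0) mulr0 addr0 => ->; rewrite !eqxx.
Qed.

(** The punctures are listed before the points and stay fixed, with trivial translation and scaling:
    [L - r] is [n], and the grades are [0..2n]. *)
Lemma upper_bound_many : uniq q -> has_motion_planners R X (2 * n + 1).
Proof.
move=> uq; have [s sP] := ell_generic uq.
pose Y x (a : 'I_(size q + n)) := match fintype.split a with inl l => q`_l | inr i => pc ch x i end.
have Yl x (a : 'I_(size q + n)) : (a < size q)%N -> Y x a = q`_a.
  by rewrite /Y; case: split_ordP => [l ->|i ->] //=; rewrite ltnNge leq_addr.
have Yr x i : Y x (rshift (size q) i) = pc ch x i.
  rewrite /Y; case: split_ordP => [l /eqP|j /rshift_inj -> //].
  by rewrite eq_sym eq_lrshift.
have := @has_motion_planners_normalized R X q n ch (size q + n) (size q) (fun a => q`_a)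
  false (@rshift (size q) n) s (leq_addr _ _) _ (fun=> 0) (fun=> 1) Y (fun c => c = 0).
rewrite addKn addn0 addn1; apply.
- by move=> a b aq bq ab; apply/val_inj/sP.
- by move=> x; exact: cts_at_cst.
- by move=> x; exact: cts_at_cst.
- move=> a x; rewrite /Y; case: (fintype.split a) => [l|i]; [exact: cts_at_cst|exact: pc_cts].
- move=> x; split; last exact: Yl.
  have [inj nq] := pc_valid ch x; move=> a b; rewrite /Y.
  case: (split_ordP a) => [l ->|i ->]; case: (split_ordP b) => [l' ->|i' ->].
  + by move/eqP; rewrite nth_uniq // => /eqP/val_inj ->.
  + by move=> e; have := nq i'; rewrite -e mem_nth.
  + by move=> e; have := nq i; rewrite e mem_nth.
  + by move/inj ->.
- by move=> x; split; [exact: oner_neq0|right].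
- by [].
- by move=> c c' t -> ->; rewrite mixx.
- move=> c z y -> [_ [//|->]] [inj yq]; split=> [i j|i].
    by rewrite /recf !add0r !mul1r => /inj/rshift_inj.
  rewrite /recf add0r mul1r; apply/negP => /(nthP 0)[l lq].
  have := yq (lshift n (Ordinal lq)) lq; rewrite /= => <- /inj/eqP.
  by rewrite eq_lrshift.
- by move=> x; apply/funext => i; rewrite /recf add0r mul1r Yr.
Qed.

(** An affine map sends the puncture to 0 and the first point to 1. Two of the [n + 1] points are
    fixed and the scaling adds one grade, so there are [2 (n - 1) + 1 + 1] grades. *)
Lemma upper_bound_one : (0 < n)%N -> size q = 1%N -> has_motion_planners R X (2 * n).
Proof.
move=> n0 sq; pose p := q`_0; pose i0 := Ordinal n0.
have pq : p \in q by rewrite mem_nth // sq.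
have qp z : (z \in q) = (z == p).
  by rewrite /p; case: (q) sq => [|x []] //= _; rewrite inE.
pose z x := pc ch x i0 - p.
have z0 x : z x != 0.
  by have [_ /(_ i0)] := pc_valid ch x; rewrite qp subr_eq0.
pose Y x (a : 'I_n.+1) := if unlift ord0 a is Some i then (pc ch x i - p) / z x else 0.
have Y0 x : Y x ord0 = 0 by rewrite /Y unlift_none.
have Yl x i : Y x (lift ord0 i) = (pc ch x i - p) / z x by rewrite /Y liftK.
have -> : (2 * n = (2 * (n.+1 - 2) + true).+1)%N by rewrite subSS; lia.
apply: (@has_motion_planners_normalized R X q n ch n.+1 2 (fun a => (a : nat)%:R)
  true (lift ord0) 0 n0 _ (fun=> p) z Y (fun c => c = p)).
- move=> [a an] [b bn] /= a2 b2; rewrite /ell !mul0r !addr0 => e.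
  apply: val_inj => /=; case: a b a2 b2 e {an bn} => [|[|//]] [|[|//]] //= _ _ /eqP.
    by rewrite eq_sym oner_eq0.
  by rewrite oner_eq0.
- by move=> x; exact: cts_at_cst.
- by move=> x; apply: cts_atB; [exact: pc_cts|exact: cts_at_cst].
- move=> a x; rewrite /Y; case: (unlift ord0 a) => [i|]; last exact: cts_at_cst.
  apply: cts_atM; first by apply: cts_atB; [exact: pc_cts|exact: cts_at_cst].
  by apply: cts_atV => //; apply: cts_atB; [exact: pc_cts|exact: cts_at_cst].
- move=> x; have [inj nq] := pc_valid ch x; split; last first.
    move=> a; case: (unliftP ord0 a) => [i ->|->]; last by rewrite Y0.
    rewrite Yl /= /bump /= add1n ltnS => i1.
    have -> : i = i0 by apply: val_inj; apply/eqP; rewrite /= -leqn0 -ltnS.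
    by rewrite -/(z x) divff.
  have Yneq0 i : Y x (lift ord0 i) != 0.
    rewrite Yl mulf_neq0 ?invr_eq0 // subr_eq0.
    by have := nq i; rewrite qp.
  move=> a b; case: (unliftP ord0 a) => [i ->|->]; case: (unliftP ord0 b) => [j ->|->] //.
  + rewrite !Yl => /(mulIf _)/addIr/inj; rewrite invr_eq0 => -> //; exact: z0.
  + by rewrite Y0 => /eqP; rewrite (negbTE (Yneq0 _)).
  + by rewrite Y0 => /eqP; rewrite eq_sym (negbTE (Yneq0 _)).
- by move=> x; split => //; left.
- by [].
- by move=> c c' t -> ->; rewrite mixx.
- move=> c w y -> [w0 _] [inj y01]; split=> [i j|i].
    by rewrite /recf => /addrI/(mulfI w0)/inj/lift_inj.
  rewrite qp /recf -subr_eq0 addrC addKr mulf_neq0 //.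
  by rewrite -[0]/(0%:R) -(y01 ord0) // (inj_eq inj) eq_sym neq_lift.
- move=> x; apply/funext => i; rewrite /recf Yl mulrC divfK //.
  by rewrite addrC subrK.
Qed.

(** The first two points are sent to 0 and 1 and the translation is free, so there are
    [2 (n - 2) + 1 + 1] grades. *)
Lemma upper_bound_none : (1 < n)%N -> q = [::] -> has_motion_planners R X (2 * n - 2).
Proof.
move=> n1 q0; pose i0 := Ordinal (ltnW n1); pose i1 := Ordinal n1.
pose z x := pc ch x i1 - pc ch x i0.
have z0 x : z x != 0.
  by have [inj _] := pc_valid ch x; rewrite subr_eq0 (inj_eq inj).
pose Y x a := (pc ch x a - pc ch x i0) / z x.
have -> : (2 * n - 2 = (2 * (n - 2) + true).+1)%N by lia.
apply: (@has_motion_planners_normalized R X q n ch n 2 (fun a => (a : nat)%:R)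
  true id 0 n1 _ (fun x => pc ch x i0) z Y (fun=> True)) => //.
- move=> [a an] [b bn] /= a2 b2; rewrite /ell !mul0r !addr0 => e.
  apply: val_inj => /=; case: a b a2 b2 e {an bn} => [|[|//]] [|[|//]] //= _ _ /eqP.
    by rewrite eq_sym oner_eq0.
  by rewrite oner_eq0.
- by move=> x; exact: pc_cts.
- by move=> x; apply: cts_atB; exact: pc_cts.
- move=> a x; apply: cts_atM; first by apply: cts_atB; exact: pc_cts.
  by apply: cts_atV => //; apply: cts_atB; exact: pc_cts.
- move=> x; have [inj _] := pc_valid ch x; split.
    by move=> a b; rewrite /Y => /(mulIf _)/addIr/inj; rewrite invr_eq0 => -> //; exact: z0.
  move=> a a2; rewrite /Y; have [a0|a0] := eqVneq a i0; first by rewrite a0 subrr mul0r.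
  have -> : a = i1.
    by apply/val_inj => /=; move: a0; rewrite -val_eqE /=; lia.
  by rewrite -/(z x) divff.
- by move=> x; split => //; left.
- move=> c w y _ [w0 _] [inj _]; split=> [i j|i]; last by rewrite q0.
  by rewrite /recf => /addrI/(mulfI w0)/inj.
- move=> x; apply/funext => i; rewrite /recf /Y mulrC divfK //.
  by rewrite addrC subrK.
Qed.

(** The space is the plane: its point is carried by the translation, and there is a single grade. *)
Lemma upper_bound_point : n = 1%N -> q = [::] -> has_motion_planners R X 1.
Proof.
move=> n1 q0; have n0 : (0 < n)%N by rewrite n1.
pose i0 := Ordinal n0.
have all0 (a : 'I_n) : a = i0 by apply/val_inj; case: a => a /= an; lia.
have -> : 1%N = (2 * (n - n) + false).+1 by rewrite subnn.
apply: (@has_motion_planners_normalized R X q n ch n n (fun=> 0)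
  false id 0 (leqnn n) _ (fun x => pc ch x i0) (fun=> 1) (fun _ _ => 0) (fun=> True)) => //.
- by move=> a b _ _ _; rewrite (all0 a) (all0 b).
- by move=> x; exact: pc_cts.
- by move=> x; exact: cts_at_cst.
- by move=> a x; exact: cts_at_cst.
- by move=> x; split=> // a b _; rewrite (all0 a) (all0 b).
- by move=> x; split; [exact: oner_neq0|right].
- by move=> c w y _ _ _; split=> [i j _|i]; rewrite ?q0 // (all0 i) (all0 j).
- by move=> x; apply/funext => i; rewrite /recf mulr0 addr0 (all0 i).
Qed.

End UpperCases.

(** * Stereographic coordinates on configuration spaces *)

Section Stereographic.
Variable R : realType.
Local Notation C := R[i].
Local Notation Re := (@complex.Re R).
Local Notation Im := (@complex.Im R).

Lemma rV3P (x y : 'rV[R]_3) : x 0 0 = y 0 0 -> x 0 1 = y 0 1 -> x 0 2%:R = y 0 2%:R -> x = y.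
Proof.
move=> h0 h1 h2; apply/rowP => -[[|[|[|//]]] i3].
- by rewrite (_ : Ordinal i3 = 0) //; exact: val_inj.
- by rewrite (_ : Ordinal i3 = 1) //; exact: val_inj.
- by rewrite (_ : Ordinal i3 = 2%:R) //; exact: val_inj.
Qed.

Lemma sum3 (f : 'I_3 -> R) : \sum_(i < 3) f i = f 0 + f 1 + f 2%:R.
Proof.
rewrite !big_ord_recl big_ord0 addr0 addrA.
by congr (_ + _ + _); congr (f _); apply: val_inj.
Qed.

Lemma sphere2E (x : 'rV[R]_3) :
  sphere2 R x <-> x 0 0 ^+ 2 + x 0 1 ^+ 2 + x 0 2%:R ^+ 2 = 1.
Proof. by rewrite /sphere2 /= sum3. Qed.

Lemma sphere2_mul (x : 'rV[R]_3) : sphere2 R x <-> x *m x^T = 1%:M.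
Proof.
have -> : x *m x^T = (\sum_(i < 3) x 0 i ^+ 2)%:M.
  rewrite [LHS]mx11_scalar mxE; congr (_ %:M); apply: eq_bigr => i _.
  by rewrite mxE expr2.
split=> [/= ->//|/matrixP /(_ 0 0)].
by rewrite !mxE eqxx mulr1n.
Qed.

(* The Householder reflection exchanging [p] with the first basis vector. *)
Lemma orthogonal_completion (p : 'rV[R]_3) : sphere2 R p ->
  exists2 P : 'M[R]_3, P *m P^T = 1%:M & delta_mx 0 0 *m P = p.
Proof.
move=> pS; pose e : 'rV[R]_3 := delta_mx 0 0.
have [pe|pe] := eqVneq p e.
  by exists 1%:M; rewrite ?trmx1 mulmx1.
pose v := p - e; pose c := 2 - 2 * p 0 0.
have ee : e *m e^T = 1%:M.
  by rewrite /e trmx_delta mul_delta_mx; apply/matrixP => i j; rewrite !ord1 !mxE !eqxx.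
have pp : p *m p^T = 1%:M by exact/sphere2_mul.
have pe0 : p *m e^T = (p 0 0)%:M.
  by rewrite /e trmx_delta -colE; apply/matrixP => i j; rewrite !ord1 !mxE eqxx mulr1n.
have ep0 : e *m p^T = (p 0 0)%:M.
  by rewrite -[LHS]trmxK trmx_mul trmxK pe0 tr_scalar_mx.
have vv : v *m v^T = c%:M.
  rewrite /v linearB /= mulmxBl !mulmxBr ee pp pe0 ep0 /c.
  by rewrite -!raddfB /=; congr (_%:M); ring.
have ev : e *m v^T = (- (c / 2))%:M.
  rewrite /v linearB /= mulmxBr ee ep0 /c -!raddfB /=; congr (_%:M); lra.
have c0 : c != 0.
  apply: contra_neq pe => c0; apply/eqP; rewrite -subr_eq0; apply/eqP/rowP => i.
  have : \sum_i v 0 i ^+ 2 = 0.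
    have /matrixP /(_ 0 0) := vv; rewrite c0 mxE [RHS]mxE mul0rn => E.
    rewrite -[RHS]E; apply: eq_bigr => j _.
    by rewrite [v^T _ _]mxE expr2.
  move/eqP; rewrite psumr_eq0 => [|j _]; last exact: sqr_ge0.
  move=> /allP /(_ i (mem_index_enum _)) /=; rewrite sqrf_eq0 => /eqP vi.
  by rewrite -/v vi mxE.
set A := v^T *m v; have AT : A^T = A by rewrite /A trmx_mul trmxK.
have AA : A *m A = c *: A.
  by rewrite /A mulmxA -[v^T *m v *m v^T]mulmxA vv mul_mx_scalar -scalemxAl.
exists (1%:M - (2 / c) *: A).
  rewrite [(1%:M - _)^T]linearB /= [(_ *: _)^T]linearZ /= AT trmx1.
  rewrite mulmxBl mul1mx mulmxBr mulmx1 -scalemxAl -scalemxAr AA !scalerA.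
  have -> : 2 / c * (2 / c) * c = 2 / c + 2 / c by field.
  by rewrite scalerDl opprB addrK subrK.
rewrite -/e mulmxBr mulmx1 -scalemxAr /A mulmxA ev mul_scalar_mx scalerA.
have -> : 2 / c * - (c / 2) = -1 by field.
by rewrite scaleN1r opprK /v addrC subrK.
Qed.

Variable P : 'M[R]_3.
Hypothesis PT : P *m P^T = 1%:M.
Let pole : 'rV[R]_3 := delta_mx 0 0 *m P.

Let TP : P^T *m P = 1%:M.
Proof. exact: mulmx1C. Qed.

(** [P^T] moves the pole to the first basis vector, from which the sphere is projected onto the last
    two coordinates. *)
Definition stereo (x : 'rV[R]_3) : C :=
  let y := x *m P^T in (y 0 1 / (1 - y 0 0) +i* (y 0 2%:R / (1 - y 0 0)))%C.

Definition stereo_inv_coord (z : C) : 'I_3 -> R := fun i =>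
  let n2 := Re z ^+ 2 + Im z ^+ 2 in
  (if i == 0 then n2 - 1 else if i == 1 then 2 * Re z else 2 * Im z) / (n2 + 1).

Definition stereo_inv (z : C) : 'rV[R]_3 := (\row_i stereo_inv_coord z i) *m P.

Lemma sphere2_rot x : sphere2 R x <-> sphere2 R (x *m P^T).
Proof. by rewrite !sphere2_mul trmx_mul trmxK mulmxA -[x *m _ *m _]mulmxA TP mulmx1. Qed.

Lemma pole_coord x : x *m P^T = delta_mx 0 0 -> x = pole.
Proof. by move=> xe; rewrite /pole -xe -mulmxA TP mulmx1. Qed.

Lemma stereo_den x : sphere2 R x -> x <> pole -> 1 - (x *m P^T) 0 0 != 0.
Proof.
move=> /sphere2_rot/sphere2E xS xp; apply: contra_notN xp; rewrite subr_eq0 => /eqP x0.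
apply: pole_coord; move: xS; rewrite -x0 expr1n; set a := _ 0 1; set b := _ 0 2%:R => ab.
have ab0 : a ^+ 2 + b ^+ 2 == 0 by apply/eqP; move: ab; lra.
move: ab0; rewrite paddr_eq0 ?sqr_ge0 // !sqrf_eq0 => /andP[/eqP a0 /eqP b0].
by apply: rV3P; rewrite [RHS]mxE /= -?x0.
Qed.

Lemma n2_gt0 (z : C) : 0 < Re z ^+ 2 + Im z ^+ 2 + 1.
Proof. by rewrite ltr_wpDl // addr_ge0 ?sqr_ge0. Qed.

Lemma stereo_inv_rot z i : (stereo_inv z *m P^T) 0 i = stereo_inv_coord z i.
Proof. by rewrite /stereo_inv -mulmxA PT mulmx1 mxE. Qed.

Lemma stereo_invK z : stereo (stereo_inv z) = z.
Proof.
have n0 := n2_gt0 z; rewrite /stereo !stereo_inv_rot /stereo_inv_coord /=.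
case: z n0 => a b /= n0; have n0' := lt0r_neq0 n0.
have E : 1 - (a ^+ 2 + b ^+ 2 - 1) / (a ^+ 2 + b ^+ 2 + 1) = 2 / (a ^+ 2 + b ^+ 2 + 1).
  by field.
by rewrite E; congr (_ +i* _)%C; field.
Qed.

Lemma stereo_inv_sphere z : sphere2 R (stereo_inv z).
Proof.
apply/sphere2_rot/sphere2E; rewrite !stereo_inv_rot /stereo_inv_coord /=.
by have := lt0r_neq0 (n2_gt0 z); case: z => a b /= n0; field.
Qed.

Lemma stereo_inv_pole z : stereo_inv z <> pole.
Proof.
move=> zp; have := stereo_inv_rot z 0; rewrite zp /pole -mulmxA PT mulmx1 mxE !eqxx.
rewrite /stereo_inv_coord /= => /eqP.
rewrite eq_sym -subr_eq0; have n0 := lt0r_neq0 (n2_gt0 z).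
move/eqP => E; have : (-2 : R) = 0.
  by rewrite -[LHS](mulfK n0) -[RHS](mul0r (Re z ^+ 2 + Im z ^+ 2 + 1)) -E; field.
by apply/eqP; rewrite oppr_eq0 pnatr_eq0.
Qed.

Lemma stereoK x : sphere2 R x -> x <> pole -> stereo_inv (stereo x) = x.
Proof.
move=> xS xp; have d0 := stereo_den xS xp; have /sphere2_rot/sphere2E yS := xS.
rewrite -[RHS]mulmx1 -TP mulmxA; set y := x *m P^T in d0 yS *.
rewrite /stereo_inv /stereo -/y; congr (_ *m P).
have a0 : y 0 1 ^+ 2 + y 0 2%:R ^+ 2 = (1 - y 0 0) * (1 + y 0 0).
  by move: yS; lra.
have n2E : (y 0 1 / (1 - y 0 0)) ^+ 2 + (y 0 2%:R / (1 - y 0 0)) ^+ 2 =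
    (1 + y 0 0) / (1 - y 0 0).
  by rewrite !expr_div_n -mulrDl a0; field.
have n2E1 : (y 0 1 / (1 - y 0 0)) ^+ 2 + (y 0 2%:R / (1 - y 0 0)) ^+ 2 + 1 =
    2 / (1 - y 0 0).
  by rewrite n2E; field.
by apply: rV3P; rewrite [LHS]mxE /stereo_inv_coord /= n2E1 ?n2E; field.
Qed.

Lemma stereo_cts x : sphere2 R x -> x <> pole -> cts_at stereo x.
Proof.
move=> xS xp; have d0 := stereo_den xS xp.
have cy i : {for x, continuous (fun x : 'rV[R]_3 => (x *m P^T) 0 i)}.
  have -> : (fun x : 'rV[R]_3 => (x *m P^T) 0 i) =
      (fun x => x 0 0 * P i 0 + x 0 1 * P i 1 + x 0 2%:R * P i 2%:R).
    by apply/funext => z; rewrite mxE sum3 ![P^T _ _]mxE.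
  have cx j : {for x, continuous (fun x : 'rV[R]_3 => x 0 j)} by exact: coord_continuous.
  have cxP j : {for x, continuous (fun x : 'rV[R]_3 => x 0 j * P i j)}.
    exact: (cvgM (cx j) (@cst_continuous _ _ (P i j) x)).
  exact: (cvgD (cvgD (cxP 0) (cxP 1)) (cxP 2%:R)).
have cd : {for x, continuous (fun x : 'rV[R]_3 => (1 - (x *m P^T) 0 0)^-1)}.
  exact: (cvgV d0 (cvgB (@cst_continuous _ _ (1 : R) x) (cy 0))).
by split; [exact: (cvgM (cy 1) cd)|exact: (cvgM (cy 2%:R) cd)].
Qed.

Lemma stereo_inv_cts (T : topologicalType) (f : T -> C) z :
  cts_at f z -> {for z, continuous (fun y => stereo_inv (f y))}.
Proof.
move=> [fr fi].
have ck (c : R) : {for z, continuous (fun _ : T => c)} by exact: cst_continuous.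
have cn : {for z, continuous (fun y => Re (f y) ^+ 2 + Im (f y) ^+ 2)}.
  exact: (cvgD (cvgM fr fr) (cvgM fi fi)).
have cd : {for z, continuous (fun y => (Re (f y) ^+ 2 + Im (f y) ^+ 2 + 1)^-1)}.
  exact: (cvgV (lt0r_neq0 (n2_gt0 (f z))) (cvgD cn (ck 1))).
have cc i : {for z, continuous (fun y => stereo_inv_coord (f y) i)}.
  rewrite /stereo_inv_coord; case: (i == 0); first exact: (cvgM (cvgB cn (ck 1)) cd).
  by case: (i == 1); [exact: (cvgM (cvgM (ck 2) fr) cd)|exact: (cvgM (cvgM (ck 2) fi) cd)].
have cj j : {for z, continuous (fun y => stereo_inv (f y) 0 j)}.
  have -> : (fun y => stereo_inv (f y) 0 j) = (fun y => stereo_inv_coord (f y) 0 * P 0 j +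
      stereo_inv_coord (f y) 1 * P 1 j + stereo_inv_coord (f y) 2%:R * P 2%:R j).
    by apply/funext => y; rewrite !mxE sum3 !mxE.
  have ccP i : {for z, continuous (fun y => stereo_inv_coord (f y) i * P i j)}.
    exact: (cvgM (cc i) (ck (P i j))).
  exact: (cvgD (cvgD (ccP 0) (ccP 1)) (ccP 2%:R)).
move=> A [B MB sBA].
have : \forall y \near z, forall j : 'I_3, B 0 j (stereo_inv (f y) 0 j).
  apply: (@filter_forall _ 'I_3 (fun j => [set y | B 0 j (stereo_inv (f y) 0 j)])
    (nbhs z) (nbhs_filter z)) => j.
  exact: (cj j _ (MB 0 j)).
by apply: filterS => y yB; apply: sBA => i j; rewrite ord1.
Qed.

End Stereographic.

Lemma continuous_at_initial (S : choiceType) (T U : topologicalType) (w : S -> U)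
    (f : T -> initial_topology w) z :
  {for z, continuous (w \o f)} -> {for z, continuous f}.
Proof.
move=> cf A [? /= [[W oW <-]]] /= Wfz /filterS; apply; apply: cf.
exact: open_nbhs_nbhs.
Qed.

(** * The chart of the configuration space of a punctured sphere *)

Section ConfigChart.
Variables (R : realType) (Q : set 'rV[R]_3) (n : nat).
Local Notation C := R[i].
Local Notation S := (punctured_sphere Q).
Variables (P : 'M[R]_3) (s : seq 'rV[R]_3).
Let pole : 'rV[R]_3 := delta_mx 0 0 *m P.
Hypothesis PT : P *m P^T = 1%:M.
Hypothesis QS : Q `<=` sphere2 R.
Hypothesis Qs : forall x, Q x <-> x = pole \/ x \in s.
Hypothesis pole_s : pole \notin s.

Let q := map (stereo P) s.

Let s_sphere x : x \in s -> sphere2 R x /\ x <> pole.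
Proof.
move=> xs; split; first by apply/QS/Qs; right.
by move=> xp; move: pole_s; rewrite -xp xs.
Qed.

Let inv_punctured z : z \notin q -> (sphere2 R `\` Q) (stereo_inv P z).
Proof.
move=> zq; split; first exact: stereo_inv_sphere.
move=> /Qs[|zs]; first exact: stereo_inv_pole.
by case/negP: zq; rewrite -(stereo_invK PT z); exact: map_f.
Qed.

Let punctured_ok x : (sphere2 R `\` Q) x ->
  [/\ sphere2 R x, x <> pole & stereo P x \notin q].
Proof.
move=> [xS xQ]; have xp : x <> pole by move=> xp; apply: xQ; apply/Qs; left.
split=> //; apply/mapP => -[y ys e]; apply: xQ; apply/Qs; right.
have [yS yp] := s_sphere ys.
by rewrite -(stereoK PT xS xp) e (stereoK PT yS yp).
Qed.

(** The points are evenly spaced on a horizontal line that contains no puncture; they serve as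
    default values of the chart. *)
Lemma exists_valid : exists u : nat -> C, forall N, valid q (fun i : 'I_N => u i).
Proof.
have [t tP] := @avoid_finite R 'I_(size q) (fun l => - complex.Im q`_l).
exists (fun i => (i%:R +i* (- t))%C) => N; split=> [i j /eqP|i].
  by rewrite eq_complex /= eqr_nat => /andP[/eqP/val_inj].
apply/negP => /(nthP 0)[l lq e]; have := tP (Ordinal lq).
by rewrite /= e opprK eqxx.
Qed.

Let Sof (x : 'rV[R]_3) (h : (sphere2 R `\` Q) x) : S :=
  exist (fun x => x \in sphere2 R `\` Q) x (mem_set h).

Lemma config_chart : inhabited (chart (config_space S n) q n).
Proof.
have [u0 u0P] := exists_valid.
have w0q : u0 0%N \notin q by have [_ /(_ ord0)] := u0P 1%N.
pose s0 : S := Sof (inv_punctured w0q).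
pose sS (z : C) : S := if pselect (z \notin q) is left h then Sof (inv_punctured h) else s0.
have sSE z : z \notin q -> \val (sS z) = stereo_inv P z.
  by rewrite /sS; case: pselect.
pose m0 (u : 'I_n -> C) : {ptws 'I_n -> S} := fun i => sS (u i).
have m0P u : valid q u -> config_set S n (m0 u).
  move=> [inj nq] i j ij e; move/negP: ij; apply; apply/eqP/inj.
  by rewrite -(stereo_invK PT (u i)) -(stereo_invK PT (u j)) -!sSE // -/(m0 u i) e.
pose Xof (u : 'I_n -> C) (h : valid q u) : config_space S n :=
  exist (fun x => x \in config_set S n) (m0 u) (mem_set (m0P u h)).
pose mkc (u : 'I_n -> C) : config_space S n :=
  if pselect (valid q u) is left h then Xof u h else Xof _ (u0P n).
have mkE u : valid q u -> \val (mkc u) = m0 u.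
  by rewrite /mkc; case: pselect.
pose pcc (x : config_space S n) : 'I_n -> C := fun i => stereo P (\val ((\val x : {ptws 'I_n -> S}) i)).
have val_ok (y : S) : [/\ sphere2 R (\val y), \val y <> pole & stereo P (\val y) \notin q].
  by apply: punctured_ok; exact: set_valP.
have pcc_valid x : valid q (pcc x).
  split=> [i j e|i]; last by have [] := val_ok ((\val x : {ptws 'I_n -> S}) i).
  have [yS yp _] := val_ok ((\val x : {ptws 'I_n -> S}) i).
  have [zS zp _] := val_ok ((\val x : {ptws 'I_n -> S}) j).
  have exy : (\val x : {ptws 'I_n -> S}) i = (\val x : {ptws 'I_n -> S}) j.
    by apply: val_inj; rewrite -(stereoK PT yS yp) -(stereoK PT zS zp) -/(pcc x i) e.
  apply/eqP/negPn/negP => ij; have xc : config_set S n (\val x) by exact: set_valP.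
  exact: (xc i j ij exy).
constructor; apply: (@Chart _ _ _ _ pcc mkc).
- exact: pcc_valid.
- move=> x; have px := pcc_valid x.
  apply: val_inj; rewrite mkE //; apply: functional_extensionality_dep => i.
  have [yS yp yq] := val_ok ((\val x : {ptws 'I_n -> S}) i).
  by apply: val_inj; rewrite /m0 sSE ?(stereoK PT yS yp).
- move=> u uv; apply/funext => i; rewrite /pcc mkE // /m0 sSE ?stereo_invK //.
  by have [] := uv.
- move=> i x; have [yS yp _] := val_ok ((\val x : {ptws 'I_n -> S}) i).
  apply: (cts_at_comp (f := stereo P) (g := fun x : config_space S n =>
     \val ((\val x : {ptws 'I_n -> S}) i))); first exact: stereo_cts.
  apply: (@continuous_comp _ _ _ (fun x : config_space S n => (\val x : {ptws 'I_n -> S}) i)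
    (fun y : S => \val y)); last exact: initial_continuous.
  apply: (@continuous_comp _ _ _ (fun x : config_space S n => (\val x : {ptws 'I_n -> S}))
    (fun f : {ptws 'I_n -> S} => f i)); first exact: initial_continuous.
  exact: (@proj_continuous 'I_n (fun=> S) i).
- move=> T u z vz uz.
  (* Validity is an open condition, so the default of [mkc] is not reached near [z]. *)
  have near_valid : \forall y \near z, valid q (u y).
    have [inj nq] := vz.
    have near1 : \forall y \near z, forall p : 'I_n * 'I_n, p.1 != p.2 -> u y p.1 - u y p.2 != 0.
      apply: (@filter_forall _ ('I_n * 'I_n)%type (fun p => [set y | p.1 != p.2 ->
        u y p.1 - u y p.2 != 0]) (nbhs z) (nbhs_filter z)) => -[i j] /=.
      have [->|ij] := eqVneq i j; first exact: nearW.
      have ne : u z i - u z j != 0 by rewrite subr_eq0 (inj_eq inj).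
      by apply: filterS (cts_at_neq0 (cts_atB (uz i) (uz j)) ne) => y h _.
    have near2 : \forall y \near z, forall p : 'I_n * 'I_(size q), u y p.1 - q`_p.2 != 0.
      apply: (@filter_forall _ ('I_n * 'I_(size q))%type (fun p => [set y | 
        u y p.1 - q`_p.2 != 0]) (nbhs z) (nbhs_filter z)) => -[i l] /=.
      have ne : u z i - q`_l != 0.
        by rewrite subr_eq0; apply: contraNneq (nq i) => ->; rewrite mem_nth.
      exact: (cts_at_neq0 (cts_atB (uz i) (cts_at_cst _ _)) ne).
    apply: filterS2 near1 near2 => y h1 h2; split=> [i j e|i].
      by apply/eqP; have := h1 (i, j); rewrite /= e subrr eqxx; case: eqVneq => // _ /(_ isT).
    apply/negP => /(nthP 0)[l lq e]; have := h2 (i, Ordinal lq).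
    by rewrite /= e subrr eqxx.
  apply: continuous_at_initial.
  suff : {for z, continuous (fun y => m0 (u y))}.
    move=> cm A; have mz : set_val (mkc (u z)) = m0 (u z) by exact: mkE.
    rewrite /= mz => mA; apply: filterS2 near_valid (cm A mA) => y vy Ay.
    have my : set_val (mkc (u y)) = m0 (u y) by exact: mkE.
    by change (A (set_val (mkc (u y)))); rewrite my.
  (* The topology is that of a product of subspaces of the space of row vectors, so continuity is
     checked on each point of the configuration. *)
  apply/cvg_sup => i.
  apply: (@continuous_at_initial _ T S (fun f : (forall i : 'I_n, S) => f i) (fun y => m0 (u y)) z).
  apply: continuous_at_initial.
  have cs := stereo_inv_cts (P := P) (uz i).
  have sE y : valid q (u y) -> set_val (m0 (u y) i) = stereo_inv P (u y i).
    by move=> [_ nq]; exact: sSE.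
  move=> A; rewrite /= (sE z vz) => sA.
  apply: filterS2 near_valid (cs A sA) => y vy Ay.
  by change (A (set_val (m0 (u y) i))); rewrite sE.
Qed.

End ConfigChart.

Lemma TC_eq (R : realType) (X : topologicalType) k : (0 < k)%N ->
  has_motion_planners R X k ->
  (forall j, has_motion_planners R X j -> (k <= j)%N) -> TC R X = k.
Proof.
move=> k0 hk kmin; rewrite /TC; apply: xget_unique => [|j [j0 hj jmin]].
  by split => // j _; exact: kmin.
by apply/eqP; rewrite eqn_leq jmin // kmin.
Qed.

(** One point of [Q] is taken as the pole and sent to infinity; the other [m - 1] give [q]. *)
Lemma punctured_sphere_chart (R : realType) (Q : set 'rV[R]_3) m n : (0 < m)%N ->
  Q `<=` sphere2 R -> (Q #= `I_m)%card ->
  exists q : seq R[i], [/\ uniq q, size q = m.-1 &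
    inhabited (chart (config_space (punctured_sphere Q) n) q n)].
Proof.
move=> m0 QS Qm.
have /finite_fsetP[F FE] : finite_set Q by apply/finite_setP; exists m.
have Fm : size (finmap.enum_fset F) = m by apply/card_eq_fsetP; rewrite -FE.
have Fu := finmap.fset_uniq F.
have FQ x : Q x <-> x \in finmap.enum_fset F by rewrite FE.
case: (finmap.enum_fset F) Fm Fu FQ => [m0'|p s]; first by rewrite -m0' in m0.
move=> /= sm /andP[ps us] FQ.
have [|P PT Pp] := @orthogonal_completion R p; first by apply/QS/FQ; rewrite inE eqxx.
have Qs x : Q x <-> x = delta_mx 0 0 *m P \/ x \in s.
  rewrite Pp; split=> [/FQ|h]; first by rewrite inE => /predU1P.
  by apply/FQ; rewrite inE; apply/predU1P.
have pole_s : delta_mx 0 0 *m P \notin s by rewrite Pp.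
exists (map (stereo P) s); split; [|by rewrite size_map -sm|exact: config_chart].
rewrite map_inj_in_uniq // => x y xs ys e.
have ok z : z \in s -> sphere2 R z /\ z <> delta_mx 0 0 *m P.
  by move=> zs; split; [apply/QS/Qs; right|move=> zp; rewrite -zp zs in pole_s].
have [xS xp] := ok x xs; have [yS yp] := ok y ys.
by rewrite -(stereoK PT xS xp) e (stereoK PT yS yp).
Qed.

Local Open Scope card_scope.

Theorem theorem6p1 (R : realType) (m n : nat) (hm : (1 <= m)%N)
    (hn : (1 <= n)%N) (Q : set 'rV[R]_3) (QS : Q `<=` sphere2 R)
    (Qm : Q #= `I_m) :
  [/\ m = 1%N -> n = 1%N ->
        TC R (config_space (punctured_sphere Q) n) = 1%N,
      m = 1%N -> (2 <= n)%N ->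
        TC R (config_space (punctured_sphere Q) n) = (2 * n - 2)%N,
      m = 2%N ->
        TC R (config_space (punctured_sphere Q) n) = (2 * n)%N &
      (3 <= m)%N ->
        TC R (config_space (punctured_sphere Q) n) = (2 * n + 1)%N].
Proof.
have [q [uq sq [ch]]] := punctured_sphere_chart n hm QS Qm.
have nonempty : exists x : config_space (punctured_sphere Q) n, True.
  by exists (mk ch (fun=> 0)).
split=> [m1 n1|m1 n2|m2|m3].
- have q0 : q = [::] by apply: size0nil; rewrite sq m1.
  apply: TC_eq => //; first exact: (upper_bound_point ch).
  (* The space is nonempty, so it is not covered by zero open sets. *)
  move=> [|//] [U [Ucov _]]; have [x _] := nonempty.
  by have : [set: _] (x, x) by []; rewrite -Ucov => -[[]].
- have q0 : q = [::] by apply: size0nil; rewrite sq m1.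
  apply: TC_eq; [lia|exact: (upper_bound_none ch)|move=> j hj].
  have := lower_bound_none ch hn n2 _ hj; rewrite q0 => /(_ erefl); lia.
- have q1 : size q = 1%N by rewrite sq m2.
  apply: TC_eq; [lia|exact: (upper_bound_one ch)|move=> j hj].
  have := lower_bound_one ch hn q1 hj; lia.
- apply: TC_eq; [lia|exact: (upper_bound_many ch)|move=> j hj].
  have q2 : (1 < size q)%N by rewrite sq; lia.
  have := lower_bound_many ch hn uq q2 hj; lia.
Qed.
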